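(* Let $I$ and $J$ be $k$-subsets of $\{1,\dots,n\}$ and let $L_I$ and $L_J$ be the corresponding rank $1$ modules. Then, as $\mathbb F[t]$-modules, $$\mathrm{Ext}^{1}_B(L_I,L_J)\cong \mathrm{Ext}^{1}_B(L_J,L_I).$$
   Context: Let $\mathbb F$ be an algebraically closed field, and let $n\ge 2$ and $1\le k\le n-1$ be integers. Elements of $\{1,\dots,n\}$ are read modulo $n$. Let $B$ be the quotient of the path algebra over $\mathbb F$ of the quiver with vertex set $\mathbb Z_n$ and arrows $x_i:i-1\to i$, $y_i:i\to i-1$ ($i\in\mathbb Z_n$) by the relations $xy=yx$ and $x^k=y^{n-k}$, one of each kind starting at every vertex (that is, $x_iy_i=y_{i+1}x_{i+1}$ at vertex $i$, paths composed as functions, and the length-$k$ path of $x$'s from $i$ to $i+k$ equals the length-$(n-k)$ path of $y$'s from $i$ to $i+k$). Its centre is $\mathbb F[t]$, $t=\sum_i x_iy_i$. Modules are left modules, i.e. representations of the quiver. For a $k$-subset $I\subseteq\{1,\dots,n\}$, the rank $1$ module $L_I$ has a copy $U_i=\mathbb F[t]$ at each vertex $i$; $x_i:U_{i-1}\to U_i$ is multiplication by $1$ if $i\in I$ and by $t$ if $i\notin I$; $y_i:U_i\to U_{i-1}$ is multiplication by $t$ if $i\in I$ and by $1$ if $i\notin I$. *)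

(* Defs.v *)
From HB Require Import structures.
From mathcomp Require Import all_boot all_order all_algebra.
From mathcomp Require Import boolp.
Set Implicit Arguments.
Unset Strict Implicit.
Unset Printing Implicit Defensive.
Import GRing.Theory.
Local Open Scope ring_scope.
Local Open Scope quotient_scope.

Section Submodules.
Variables (R : nzRingType) (V : lmodType R) (S : {pred V}).
Hypothesis HS : submod_closed S.

(* Alias of S carrying the closure proof, for instance inference. *)
Definition submod_pred of submod_closed S : {pred V} := S.
HB.instance Definition _ := GRing.isSubmodClosed.Build R V (submod_pred HS) HS.

Definition submod := {v : V | v \in submod_pred HS}.
HB.instance Definition _ := SubType.copy submod {v : V | v \in submod_pred HS}.
HB.instance Definition _ := [Choice of submod by <:].
HB.instance Definition _ := [SubChoice_isSubLmodule of submod by <:].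

Definition quotmod := Quotient.quot (submod_pred HS).
HB.instance Definition _ := GRing.Zmodule.on quotmod.

Definition quot_scale (a : R) (u : quotmod) : quotmod := \pi_quotmod (a *: repr u).

Lemma pi_scale a (u : V) : quot_scale a (\pi_quotmod u) = \pi_quotmod (a *: u).
Proof.
apply/eqP; rewrite /quot_scale -Quotient.idealrBE -scalerBr rpredZ //.
by rewrite Quotient.idealrBE reprK.
Qed.

Lemma pi_add (u v : V) : \pi_quotmod (u + v) = \pi_quotmod u + \pi_quotmod v.
Proof. exact: (@Quotient.pi_add V (submod_pred HS)). Qed.

Lemma quot_scaleA a b u : quot_scale a (quot_scale b u) = quot_scale (a * b) u.
Proof. by rewrite -[u](@reprK _ quotmod) 3!pi_scale scalerA. Qed.
Lemma quot_scale1 : left_id 1 quot_scale.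
Proof. by move=> u; rewrite -[u](@reprK _ quotmod) pi_scale scale1r. Qed.
Lemma quot_scaleDr : right_distributive quot_scale +%R.
Proof.
move=> a u v; rewrite -[u](@reprK _ quotmod) -[v](@reprK _ quotmod).
by rewrite -pi_add 3!pi_scale scalerDr pi_add.
Qed.
Lemma quot_scaleDl u : {morph quot_scale^~ u : a b / a + b}.
Proof.
by move=> a b; rewrite -[u](@reprK _ quotmod) 3!pi_scale scalerDl pi_add.
Qed.

HB.instance Definition _ := GRing.Zmodule_isLmodule.Build R quotmod
  quot_scaleA quot_scale1 quot_scaleDr quot_scaleDl.
End Submodules.

Section PolyAction.
Variables (F : fieldType) (V : lmodType F) (T : {linear V -> V}).

Definition poly_act (p : {poly F}) (v : V) : V :=
  \sum_(j < size p) p`_j *: iter j T v.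

Lemma poly_actE m (p : {poly F}) v : (size p <= m)%N ->
  poly_act p v = \sum_(j < m) p`_j *: iter j T v.
Proof.
move=> le_pm; rewrite /poly_act (big_ord_widen m (fun j => p`_j *: iter j T v)) //.
rewrite [RHS](bigID (fun j : 'I_m => (j < size p)%N)) /= [X in _ + X]big1 ?addr0 //.
by move=> j; rewrite -leqNgt => /(nth_default _) ->; rewrite scale0r.
Qed.

Lemma poly_actDl v : {morph poly_act^~ v : p q / p + q}.
Proof.
move=> p q; have le1 := leq_maxl (size p) (size q).
have le2 := leq_maxr (size p) (size q).
rewrite (poly_actE _ (size_polyD p q)) (poly_actE _ le1) (poly_actE _ le2).
by rewrite -big_split; apply: eq_bigr => j _; rewrite coefD scalerDl.
Qed.

Lemma iter_linear j a u v : iter j T (a *: u + v) = a *: iter j T u + iter j T v.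
Proof. by elim: j => //= j ->; rewrite linearP. Qed.

Lemma poly_act_linear p a u v :
  poly_act p (a *: u + v) = a *: poly_act p u + poly_act p v.
Proof.
rewrite /poly_act scaler_sumr -big_split; apply: eq_bigr => j _ /=.
by rewrite iter_linear scalerDr !scalerA mulrC.
Qed.

Lemma poly_actC c v : poly_act c%:P v = c *: v.
Proof. by rewrite (poly_actE _ (size_polyC_leq1 c)) big_ord1 coefC. Qed.

Lemma poly_act1 : left_id 1 poly_act.
Proof. by move=> v; rewrite poly_actC scale1r. Qed.

Lemma poly_act_mulX p v : poly_act (p * 'X) v = T (poly_act p v).
Proof.
have le_pX : (size (p * 'X)%R <= (size p).+1)%N.
  by rewrite (leq_trans (size_polyMleq _ _)) // size_polyX addn2.
rewrite (poly_actE _ le_pX) big_ord_recl coefMX scale0r add0r linear_sum.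
by apply: eq_bigr => j _; rewrite coefMX linearZ.
Qed.

Lemma poly_act_C_mul c p v : poly_act (c%:P * p) v = c *: poly_act p v.
Proof.
have le_cp : (size (c%:P * p)%R <= size p)%N by rewrite mul_polyC size_scale_leq.
rewrite (poly_actE _ le_cp) scaler_sumr; apply: eq_bigr => j _.
by rewrite coefCM scalerA.
Qed.

Lemma poly_actA p q v : poly_act p (poly_act q v) = poly_act (p * q) v.
Proof.
elim/poly_ind: p => [|p c IHp]; first by rewrite mul0r /poly_act size_poly0 !big_ord0.
rewrite mulrDl !poly_actDl poly_act_C_mul poly_actC; congr (_ + _).
by rewrite poly_act_mulX IHp -mulrA ['X * q]mulrC mulrA poly_act_mulX.
Qed.
End PolyAction.

Lemma poly_act_morph (F : fieldType) (V W : lmodType F) (T : {linear V -> V})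
    (T' : {linear W -> W}) (f : {linear V -> W}) p v :
  (forall u, f (T u) = T' (f u)) -> f (poly_act T p v) = poly_act T' p (f v).
Proof.
move=> fT; rewrite /poly_act linear_sum; apply: eq_bigr => j _.
by rewrite linearZ; congr (_ *: _); elim: {+}(j : nat) => //= m <-.
Qed.

Section Representations.
Variables (F : fieldType) (n k : nat).

(* Vertices are residues mod n (n >= 2 in all uses), the label n being 0. The
   arrows are x_i : i - 1 -> i and y_i : i -> i - 1, for i in 'Z_n. For i : 'Z_n,
   down m i = i - m; xpath is the path of m x's from i - m to i and ypath the
   path of m y's from i to i - m. *)
Definition down (m : nat) (i : 'Z_n) : 'Z_n := iter m (fun j => j - 1) i.

Section Paths.
Variables (U : 'Z_n -> lmodType F).
Variables (x : forall i, {linear U (i - 1) -> U i}).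
Variables (y : forall i, {linear U i -> U (i - 1)}).

Fixpoint xpath (m : nat) (i : 'Z_n) : U (down m i) -> U i :=
  if m is m'.+1 then fun u => xpath (x (down m' i) u) else id.

Fixpoint ypath (m : nat) (i : 'Z_n) (u : U i) : U (down m i) :=
  if m is m'.+1 then y (down m' i) (ypath m' u) else u.
End Paths.

(* Left modules over the path algebra modulo xy = yx and x^k = y^(n - k), as
   representations of the bound quiver. The relation xy = yx is written at the
   vertex i - 1, where both sides typecheck. The two paths from i - k end at i
   and at down (n - k) (i - k), which is only propositionally equal to i, so
   x^k = y^(n - k) is stated in the total space {i & U i}. *)
Record rep := Rep {
  rsp :> 'Z_n -> lmodType F;
  rx : forall i, {linear rsp (i - 1) -> rsp i};
  ry : forall i, {linear rsp i -> rsp (i - 1)};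
  rep_comm : forall i (u : rsp (i - 1)), rx (i - 1) (ry (i - 1) u) = ry i (rx i u);
  rep_path : forall i (u : rsp (down k i)),
    Tagged rsp (xpath rx u) = Tagged rsp (ypath ry (n - k)%N u)
}.

(* The central element t = \sum_i x_i y_i acts on M i by x_i y_i. *)
Definition taction (M : rep) i (u : M i) : M i := rx M i (ry M i u).

Lemma taction_is_linear (M : rep) i : linear (@taction M i).
Proof. by move=> a u v; rewrite /taction !linearP. Qed.
HB.instance Definition _ (M : rep) i :=
  GRing.isLinear.Build F (M i) (M i) *:%R (@taction M i) (@taction_is_linear M i).

Definition pact (M : rep) i (p : {poly F}) (u : M i) : M i :=
  poly_act (@taction M i) p u.

Record hom (M N : rep) := Hom {
  hfun :> forall i, M i -> N i;
  hom_linear : forall i, linear (@hfun i);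
  hom_x : forall i (u : M (i - 1)), @hfun i (rx M i u) = rx N i (@hfun (i - 1) u);
  hom_y : forall i (u : M i), @hfun (i - 1) (ry M i u) = ry N i (@hfun i u)
}.
Arguments hfun {M N} h i u : rename.

HB.instance Definition _ (M N : rep) (f : hom M N) i :=
  GRing.isLinear.Build F (M i) (N i) *:%R (f i) (@hom_linear M N f i).

HB.instance Definition _ (M N : rep) := gen_eqMixin (hom M N).
HB.instance Definition _ (M N : rep) := gen_choiceMixin (hom M N).

Lemma hom_zero (M N : rep) (f : hom M N) i : f i 0 = 0.
Proof. exact: linear0. Qed.
Lemma homD (M N : rep) (f : hom M N) i u v : f i (u + v) = f i u + f i v.
Proof. exact: linearD. Qed.
Lemma homZ (M N : rep) (f : hom M N) i a u : f i (a *: u) = a *: f i u.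
Proof. exact: linearZ. Qed.

Lemma homP (M N : rep) (f g : hom M N) : (forall i, f i =1 g i) -> f = g.
Proof.
case: f g => [f fl fx fy] [g gl gx gy] /= fg.
have {}fg : f = g by apply: functional_extensionality_dep => i; apply/funext/fg.
by subst g; congr Hom; apply: Prop_irrelevance.
Qed.

(* F[t] acts on homomorphisms through the centre: (t f) u = t (f u). *)
Section HomModule.
Variables (M N : rep).
Implicit Types f g h : hom M N.

Lemma hom0_linear i : linear (fun _ : M i => 0 : N i).
Proof. by move=> a u v; rewrite scaler0 addr0. Qed.
Definition hom0 : hom M N.
Proof.
exists (fun i _ => 0); first exact: hom0_linear.
all: by move=> i u; rewrite linear0.
Defined.

Definition hom_opp f : hom M N.
Proof.
exists (fun i u => - f i u).
- by move=> i a u v; rewrite linearP opprD scalerN.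
- by move=> i u; rewrite hom_x linearN.
- by move=> i u; rewrite hom_y linearN.
Defined.

Definition hom_add f g : hom M N.
Proof.
exists (fun i u => f i u + g i u).
- by move=> i a u v; rewrite !linearP scalerDr addrACA.
- by move=> i u; rewrite !hom_x linearD.
- by move=> i u; rewrite !hom_y linearD.
Defined.

Lemma taction_x (L : rep) i (u : L (i - 1)) :
  rx L i (taction u) = taction (rx L i u).
Proof. by rewrite /taction rep_comm. Qed.

Lemma taction_y (L : rep) i (u : L i) : ry L i (taction u) = taction (ry L i u).
Proof. by rewrite /taction -rep_comm. Qed.

Definition hom_scale (p : {poly F}) f : hom M N.
Proof.
exists (fun i u => pact p (f i u)).
- by move=> i a u v; rewrite linearP /pact poly_act_linear.
- move=> i u; rewrite hom_x; apply/esym.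
  by apply: poly_act_morph => v; apply: taction_x.
- move=> i u; rewrite hom_y; apply/esym.
  by apply: poly_act_morph => v; apply: taction_y.
Defined.

Lemma hom_addA : associative hom_add.
Proof. by move=> f g h; apply: homP => i u /=; rewrite addrA. Qed.
Lemma hom_addC : commutative hom_add.
Proof. by move=> f g; apply: homP => i u /=; rewrite addrC. Qed.
Lemma hom_add0 : left_id hom0 hom_add.
Proof. by move=> f; apply: homP => i u /=; rewrite add0r. Qed.
Lemma hom_addN : left_inverse hom0 hom_opp hom_add.
Proof. by move=> f; apply: homP => i u /=; rewrite addNr. Qed.
HB.instance Definition _ :=
  GRing.isZmodule.Build (hom M N) hom_addA hom_addC hom_add0 hom_addN.

Lemma hom_scaleA p q f : hom_scale p (hom_scale q f) = hom_scale (p * q) f.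
Proof. by apply: homP => i u; apply: poly_actA. Qed.
Lemma hom_scale1 : left_id 1 hom_scale.
Proof. by move=> f; apply: homP => i u; apply: poly_act1. Qed.
Lemma hom_scaleDr : right_distributive hom_scale +%R.
Proof.
move=> p f g; apply: homP => i u; rewrite /= /pact.
by have := poly_act_linear (@taction N i) p 1 (f i u) (g i u); rewrite !scale1r.
Qed.
Lemma hom_scaleDl f : {morph hom_scale^~ f : p q / p + q}.
Proof. by move=> p q; apply: homP => i u; apply: poly_actDl. Qed.
HB.instance Definition _ := GRing.Zmodule_isLmodule.Build {poly F} (hom M N)
  hom_scaleA hom_scale1 hom_scaleDr hom_scaleDl.
End HomModule.

Definition hom_comp (L M N : rep) (g : hom M N) (f : hom L M) : hom L N.
Proof.
exists (fun i u => g i (f i u)).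
- by move=> i a u v; rewrite !linearP.
- by move=> i u; rewrite !hom_x.
- by move=> i u; rewrite !hom_y.
Defined.

Lemma hom_compP (L M N : rep) (f : hom L M) p (g h : hom M N) :
  hom_comp (p *: g + h) f = p *: hom_comp g f + hom_comp h f.
Proof. exact: homP. Qed.

Lemma hom_comp0l (L M N : rep) (f : hom L M) : hom_comp (0 : hom M N) f = 0.
Proof. exact: homP. Qed.

Definition hom_surjective (M N : rep) (f : hom M N) :=
  forall i (v : N i), exists u, f i u = v.

Definition projective (P : rep) := forall (M N : rep) (g : hom M N) (f : hom P N),
  hom_surjective g -> exists h : hom P M, hom_comp g h = f.

Definition exact (L M N : rep) (f : hom L M) (g : hom M N) :=
  forall i (u : M i), g i u = 0 <-> exists v, f i v = u.

Record proj_resolution (M : rep) := ProjResolution {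
  rterm :> nat -> rep;
  rdiff : forall m, hom (rterm m.+1) (rterm m);
  raug : hom (rterm 0) M;
  rterm_projective : forall m, projective (rterm m);
  raug_surjective : hom_surjective raug;
  raug_exact : exact (rdiff 0) raug;
  rdiff_exact : forall m, exact (rdiff m.+1) (rdiff m)
}.

(* Ext^1_B(M, N) = H^1(Hom_B(P, N)), with its F[t]-module structure. *)
Section Ext.
Variables (M : rep) (P : proj_resolution M) (N : rep).

Definition cocycle : {pred hom (P 1) N} :=
  fun f => `[< hom_comp f (rdiff P 1) = 0 >].

Lemma cocycle_closed : submod_closed cocycle.
Proof.
split=> [|p f g /asboolP f0 /asboolP g0]; apply/asboolP; first exact: hom_comp0l.
by rewrite hom_compP f0 g0 scaler0 addr0.
Qed.

Definition coboundary : {pred submod cocycle_closed} :=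
  fun f => `[< exists g : hom (P 0) N, val f = hom_comp g (rdiff P 0) >].

Lemma coboundary_closed : submod_closed coboundary.
Proof.
split=> [|p f g /asboolP[f' ff'] /asboolP[g' gg']]; apply/asboolP.
  by exists 0; rewrite hom_comp0l.
by exists (p *: f' + g'); rewrite hom_compP -ff' -gg' linearP.
Qed.

Definition Ext1 : lmodType {poly F} := quotmod coboundary_closed.
End Ext.

Lemma hom_xpath (M N : rep) (f : hom M N) m i (u : M (down m i)) :
  f i (xpath (rx M) u) = xpath (rx N) (f (down m i) u).
Proof. by elim: m u => //= m IHm u; rewrite IHm hom_x. Qed.

Lemma hom_ypath (M N : rep) (f : hom M N) m i (u : M i) :
  f (down m i) (ypath (ry M) m u) = ypath (ry N) m (f i u).
Proof. by elim: m => //= m <-; rewrite hom_y. Qed.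

(* Every representation has a projective resolution. The free representation on
   a family of sets S of generators is built as formal terms modulo the
   congruence generated by the axioms of representations. *)
Section Free.
Variable S : 'Z_n -> Type.

Inductive term : 'Z_n -> Type :=
| Gen i of S i : term i
| Zero i : term i
| Add i of term i & term i : term i
| Scale i of F & term i : term i
| TX i of term (i - 1) : term i
| TY i of term i : term (i - 1).

Fixpoint xterm (m : nat) (i : 'Z_n) : term (down m i) -> term i :=
  if m is m'.+1 then fun u => xterm (@TX (down m' i) u) else id.
Fixpoint yterm (m : nat) (i : 'Z_n) (u : term i) : term (down m i) :=
  if m is m'.+1 then @TY (down m' i) (yterm m' u) else u.

Inductive teq : forall i, term i -> term i -> Prop :=
| teq_refl i (u : term i) : teq u u
| teq_sym i (u v : term i) : teq u v -> teq v u
| teq_trans i (u v w : term i) : teq u v -> teq v w -> teq u w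
| teq_addA i (u v w : term i) : teq (Add u (Add v w)) (Add (Add u v) w)
| teq_addC i (u v : term i) : teq (Add u v) (Add v u)
| teq_add0 i (u : term i) : teq (Add (Zero i) u) u
| teq_addN i (u : term i) : teq (Add (Scale (- 1) u) u) (Zero i)
| teq_scaleA i a b (u : term i) : teq (Scale a (Scale b u)) (Scale (a * b) u)
| teq_scale1 i (u : term i) : teq (Scale 1 u) u
| teq_scaleDr i a (u v : term i) :
    teq (Scale a (Add u v)) (Add (Scale a u) (Scale a v))
| teq_scaleDl i a b (u : term i) :
    teq (Scale (a + b) u) (Add (Scale a u) (Scale b u))
| teq_TX i a (u v : term (i - 1)) :
    teq (TX (Add (Scale a u) v)) (Add (Scale a (TX u)) (TX v))
| teq_TY i a (u v : term i) :
    teq (TY (Add (Scale a u) v)) (Add (Scale a (TY u)) (TY v))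
| teq_comm i (u : term (i - 1)) : teq (TX (TY u)) (TY (TX u))
| teq_path i (u : term (down k i)) (v : term i) :
    Tagged term v = Tagged term (yterm (n - k)%N u) -> teq (xterm u) v
| teq_cAdd i (u v u' v' : term i) :
    teq u u' -> teq v v' -> teq (Add u v) (Add u' v')
| teq_cScale i a (u u' : term i) : teq u u' -> teq (Scale a u) (Scale a u')
| teq_cTX i (u u' : term (i - 1)) : teq u u' -> teq (TX u) (TX u')
| teq_cTY i (u u' : term i) : teq u u' -> teq (TY u) (TY u').

HB.instance Definition _ i := gen_eqMixin (term i).
HB.instance Definition _ i := gen_choiceMixin (term i).

Definition teqb i (u v : term i) := `[< teq u v >].
Lemma teqb_equiv i : equiv_class_of (@teqb i).
Proof.
split=> [u|u v|v u w]; first exact/asboolP/teq_refl.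
  by apply/asboolP/asboolP; apply: teq_sym.
by move=> /asboolP uv /asboolP vw; apply/asboolP/(teq_trans uv vw).
Qed.
Canonical teqb_equiv_rel i := EquivRelPack (@teqb_equiv i).

Definition free i := {eq_quot @teqb i}.
HB.instance Definition _ i := Choice.on (free i).
HB.instance Definition _ i := EqQuotient.on (free i).

Definition cls i (u : term i) : free i := \pi_(free i) u.
Lemma clsP i (u v : term i) : cls u = cls v <-> teq u v.
Proof.
split=> [/eqmodP/asboolP //|uv]; exact/eqmodP/asboolP.
Qed.
Lemma teq_repr i (u : term i) : teq (repr (cls u)) u.
Proof. by apply/clsP; rewrite /cls reprK. Qed.
Lemma clsK i (u : free i) : cls (repr u) = u.
Proof. exact: reprK. Qed.

Definition free_add i (u v : free i) : free i := cls (Add (repr u) (repr v)).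
Definition free_scale i a (u : free i) : free i := cls (Scale a (repr u)).
Definition free_x i (u : free (i - 1)) : free i := cls (TX (repr u)).
Definition free_y i (u : free i) : free (i - 1) := cls (TY (repr u)).

Lemma free_addE i (u v : term i) : free_add (cls u) (cls v) = cls (Add u v).
Proof. by apply/clsP/teq_cAdd; apply: teq_repr. Qed.
Lemma free_scaleE i a (u : term i) : free_scale a (cls u) = cls (Scale a u).
Proof. by apply/clsP/teq_cScale; apply: teq_repr. Qed.
Lemma free_xE i (u : term (i - 1)) : free_x (cls u) = cls (TX u).
Proof. by apply/clsP/teq_cTX; apply: teq_repr. Qed.
Lemma free_yE i (u : term i) : free_y (cls u) = cls (TY u).
Proof. by apply/clsP/teq_cTY; apply: teq_repr. Qed.

Lemma free_addA i : associative (@free_add i).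
Proof.
move=> u v w; rewrite -[u]clsK -[v]clsK -[w]clsK !free_addE.
exact/clsP/teq_addA.
Qed.
Lemma free_addC i : commutative (@free_add i).
Proof. by move=> u v; rewrite -[u]clsK -[v]clsK !free_addE; apply/clsP/teq_addC. Qed.
Lemma free_add0 i : left_id (cls (Zero i)) (@free_add i).
Proof. by move=> u; rewrite -[u]clsK free_addE; apply/clsP/teq_add0. Qed.
Lemma free_addN i : left_inverse (cls (Zero i)) (@free_scale i (- 1)) (@free_add i).
Proof.
by move=> u; rewrite -[u]clsK free_scaleE free_addE; apply/clsP/teq_addN.
Qed.
HB.instance Definition _ i := GRing.isZmodule.Build (free i)
  (@free_addA i) (@free_addC i) (@free_add0 i) (@free_addN i).

Lemma cls_add i (u v : term i) : cls u + cls v = cls (Add u v).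
Proof. exact: free_addE. Qed.

Lemma free_scaleA i a b (u : free i) :
  free_scale a (free_scale b u) = free_scale (a * b) u.
Proof. by rewrite -[u]clsK !free_scaleE; apply/clsP/teq_scaleA. Qed.
Lemma free_scale1 i : left_id 1 (@free_scale i).
Proof. by move=> u; rewrite -[u]clsK free_scaleE; apply/clsP/teq_scale1. Qed.
Lemma free_scaleDr i : right_distributive (@free_scale i) +%R.
Proof.
move=> a u v; rewrite -[u]clsK -[v]clsK cls_add !free_scaleE cls_add.
exact/clsP/teq_scaleDr.
Qed.
Lemma free_scaleDl i (u : free i) : {morph (@free_scale i)^~ u : a b / a + b}.
Proof.
by move=> a b; rewrite -[u]clsK !free_scaleE cls_add; apply/clsP/teq_scaleDl.
Qed.
HB.instance Definition _ i := GRing.Zmodule_isLmodule.Build F (free i)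
  (@free_scaleA i) (@free_scale1 i) (@free_scaleDr i) (@free_scaleDl i).

Lemma cls_scale i a (u : term i) : a *: cls u = cls (Scale a u).
Proof. exact: free_scaleE. Qed.

Lemma free_x_linear i : linear (@free_x i).
Proof.
move=> a u v; rewrite -[u]clsK -[v]clsK cls_scale cls_add !free_xE.
by rewrite cls_scale cls_add; apply/clsP/teq_TX.
Qed.
HB.instance Definition _ i :=
  GRing.isLinear.Build F (free (i - 1)) (free i) *:%R (@free_x i) (@free_x_linear i).
Lemma free_y_linear i : linear (@free_y i).
Proof.
move=> a u v; rewrite -[u]clsK -[v]clsK cls_scale cls_add !free_yE.
by rewrite cls_scale cls_add; apply/clsP/teq_TY.
Qed.
HB.instance Definition _ i :=
  GRing.isLinear.Build F (free i) (free (i - 1)) *:%R (@free_y i) (@free_y_linear i).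

Let U i : lmodType F := free i.
Let X i : {linear U (i - 1) -> U i} := @free_x i.
Let Y i : {linear U i -> U (i - 1)} := @free_y i.

Lemma free_xpath m i (u : term (down m i)) : xpath X (cls u : U _) = cls (xterm u).
Proof. by elim: m u => //= m IHm u; rewrite free_xE IHm. Qed.
Lemma free_ypath m i (u : term i) : ypath Y m (cls u : U _) = cls (yterm m u).
Proof. by elim: m => //= m ->; rewrite free_yE. Qed.

Lemma free_comm i (u : U (i - 1)) : X (i - 1) (Y (i - 1) u) = Y i (X i u).
Proof.
by rewrite -[u]clsK /= free_xE !free_yE free_xE; apply/clsP/teq_comm.
Qed.

Hypothesis downK : forall i, down (n - k) (down k i) = i.

Lemma free_path i (u : U (down k i)) :
  Tagged U (xpath X u) = Tagged U (ypath Y (n - k)%N u).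
Proof.
rewrite -[u]clsK free_xpath free_ypath.
move: (yterm _ _) (@teq_path i (repr u)); rewrite downK => v eq_v.
by congr (Tagged U _); apply/clsP/eq_v.
Qed.

Definition free_rep : rep := Rep free_comm free_path.

Variables (N : rep) (s : forall i, S i -> N i).

Fixpoint eval i (u : term i) : N i :=
  match u in term i return N i with
  | Gen i a => s a
  | Zero i => 0
  | Add i u v => eval u + eval v
  | Scale i a u => a *: eval u
  | TX i u => rx N i (eval u)
  | TY i u => ry N i (eval u)
  end.

Lemma eval_xterm m i (u : term (down m i)) :
  eval (xterm u) = xpath (rx N) (eval u).
Proof. by elim: m u => //= m IHm u; rewrite IHm. Qed.
Lemma eval_yterm m i (u : term i) : eval (yterm m u) = ypath (ry N) m (eval u).
Proof. by elim: m => //= m ->. Qed.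

Lemma eval_teq i (u v : term i) : teq u v -> eval u = eval v.
Proof.
elim=> {i u v} /=.
- by [].
- by move=> i u v _ ->.
- by move=> i u v w _ -> _ ->.
- by move=> i u v w; rewrite addrA.
- by move=> i u v; rewrite addrC.
- by move=> i u; rewrite add0r.
- by move=> i u; rewrite scaleN1r addNr.
- by move=> i a b u; rewrite scalerA.
- by move=> i u; rewrite scale1r.
- by move=> i a u v; rewrite scalerDr.
- by move=> i a b u; rewrite scalerDl.
- by move=> i a u v; rewrite linearP.
- by move=> i a u v; rewrite linearP.
- by move=> i u; rewrite rep_comm.
- move=> i u v eq_v; apply/eqP; rewrite eval_xterm.
  have := rep_path (eval u); rewrite -eval_yterm.
  have -> : Tagged (rsp N) (eval (yterm (n - k)%N u)) = Tagged (rsp N) (eval v).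
    by move: (congr1 (fun t => Tagged (rsp N) (eval (tagged t))) eq_v).
  by move/eqP; rewrite eq_Tagged.
- by move=> i u v u' v' _ -> _ ->.
- by move=> i a u u' _ ->.
- by move=> i u u' _ ->.
- by move=> i u u' _ ->.
Qed.

Definition free_lift : hom free_rep N.
Proof.
exists (fun i (u : free i) => eval (repr u)).
- move=> i a u v; rewrite -[u]clsK -[v]clsK cls_scale cls_add.
  by rewrite !(eval_teq (teq_repr _)).
- by move=> i u; rewrite (eval_teq (teq_repr _)).
- by move=> i u; rewrite (eval_teq (teq_repr _)).
Defined.

Lemma free_liftE i (a : S i) : free_lift i (cls (Gen a)) = s a.
Proof. by rewrite /= (eval_teq (teq_repr _)). Qed.

Lemma free_homP (f g : hom free_rep N) :
  (forall i (a : S i), f i (cls (Gen a)) = g i (cls (Gen a))) -> f = g.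
Proof.
move=> eq_fg; apply: homP => i u; rewrite -[u]clsK.
elim: (repr u) => {i u} //=.
- move=> i; have -> : cls (Zero i) = 0 by [].
  by rewrite (hom_zero f) (hom_zero g).
- move=> i u IHu v IHv; rewrite -cls_add.
  by rewrite (homD f) (homD g) IHu IHv.
- move=> i a u IHu; rewrite -cls_scale.
  by rewrite (homZ f) (homZ g) IHu.
- by move=> i u IHu; rewrite -free_xE (hom_x f) (hom_x g) IHu.
- by move=> i u IHu; rewrite -free_yE (hom_y f) (hom_y g) IHu.
Qed.
End Free.

Lemma free_rep_projective S downK : projective (@free_rep S downK).
Proof.
move=> M N g f g_surj.
have s_ex i (a : S i) : exists u : M i, g i u = f i (cls (Gen a)) by apply: g_surj.
pose s i a := sval (cid (s_ex i a)).
exists (free_lift downK s); apply: free_homP => i a.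
rewrite [LHS](congr1 (g i) (free_liftE downK s a)).
exact: svalP (cid (s_ex i a)).
Qed.

Lemma rep_downK (M : rep) i : down (n - k) (down k i) = i.
Proof. exact: esym (congr1 tag (rep_path (0 : M (down k i)))). Qed.

Section Kernel.
Variables (M N : rep) (f : hom M N).

Definition ker_pred i : {pred M i} := fun u => f i u == 0.
Lemma ker_closed i : submod_closed (@ker_pred i).
Proof.
split=> [|a u v /eqP fu /eqP fv]; apply/eqP; first exact: hom_zero.
by rewrite homD homZ fu fv scaler0 addr0.
Qed.

Let U i : lmodType F := submod (@ker_closed i).

Lemma ker_x_subproof i (u : U (i - 1)) : rx M i (val u) \in submod_pred (@ker_closed i).
Proof.
by apply/eqP; rewrite hom_x; have /eqP-> := valP u; rewrite linear0.
Qed.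
Lemma ker_y_subproof i (u : U i) : ry M i (val u) \in submod_pred (@ker_closed (i - 1)).
Proof.
by apply/eqP; rewrite hom_y; have /eqP-> := valP u; rewrite linear0.
Qed.

Definition ker_x i (u : U (i - 1)) : U i := Sub (rx M i (val u)) (ker_x_subproof u).
Definition ker_y i (u : U i) : U (i - 1) := Sub (ry M i (val u)) (ker_y_subproof u).

Lemma ker_x_linear i : linear (@ker_x i).
Proof. by move=> a u v; apply: val_inj; rewrite /= !linearP. Qed.
HB.instance Definition _ i :=
  GRing.isLinear.Build F (U (i - 1)) (U i) *:%R (@ker_x i) (@ker_x_linear i).
Lemma ker_y_linear i : linear (@ker_y i).
Proof. by move=> a u v; apply: val_inj; rewrite /= !linearP. Qed.
HB.instance Definition _ i :=
  GRing.isLinear.Build F (U i) (U (i - 1)) *:%R (@ker_y i) (@ker_y_linear i).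

Let X i : {linear U (i - 1) -> U i} := @ker_x i.
Let Y i : {linear U i -> U (i - 1)} := @ker_y i.

Lemma val_xpath m i (u : U (down m i)) : val (xpath X u) = xpath (rx M) (val u).
Proof. by elim: m u => //= m IHm u; rewrite IHm. Qed.
Lemma val_ypath m i (u : U i) : val (ypath Y m u) = ypath (ry M) m (val u).
Proof. by elim: m => //= m <-. Qed.

Lemma ker_comm i (u : U (i - 1)) : X (i - 1) (Y (i - 1) u) = Y i (X i u).
Proof. by apply: val_inj; rewrite /= rep_comm. Qed.

Lemma ker_path i (u : U (down k i)) :
  Tagged U (xpath X u) = Tagged U (ypath Y (n - k)%N u).
Proof.
have := rep_path (val u); rewrite -val_xpath -val_ypath.
move: (xpath X u) (ypath Y _ u).
rewrite (rep_downK M i).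
move=> v w /eqP; rewrite eq_Tagged => /eqP vw.
by congr (Tagged U _); apply: val_inj.
Qed.

Definition ker : rep := Rep ker_comm ker_path.

Definition ker_incl : hom ker M.
Proof. by exists (fun i (u : U i) => val u). Defined.
End Kernel.

Definition cover (M : rep) : rep := free_rep (fun i => M i) (rep_downK M).
Definition cover_map (M : rep) : hom (cover M) M :=
  free_lift (S := fun i => M i) (rep_downK M) (fun i u => u).

Lemma cover_map_surjective (M : rep) : hom_surjective (cover_map M).
Proof. by move=> i u; exists (cls (Gen u)); apply: free_liftE. Qed.

Fixpoint syzygy (M : rep) m : rep :=
  if m is m'.+1 then ker (cover_map (syzygy M m')) else M.

Lemma syzygy_exact (M : rep) m :
  exact (hom_comp (ker_incl (cover_map (syzygy M m))) (cover_map (syzygy M m.+1)))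
        (cover_map (syzygy M m)).
Proof.
move=> i u; split=> [fu0|[v <-]]; last by apply/eqP/(valP (cover_map _ i v)).
have u_ker : u \in submod_pred (@ker_closed _ _ (cover_map (syzygy M m)) i).
  exact/eqP.
have [v def_v] := @cover_map_surjective (syzygy M m.+1) i (Sub u u_ker).
by exists v; rewrite [LHS](congr1 val def_v).
Qed.

Lemma proj_resolution_exists (M : rep) : inhabited (proj_resolution M).
Proof.
split; exists (fun m => cover (syzygy M m))
  (fun m => hom_comp (ker_incl (cover_map (syzygy M m))) (cover_map (syzygy M m.+1)))
  (cover_map M).
- by move=> m; apply: free_rep_projective.
- exact: cover_map_surjective.
- exact: (@syzygy_exact M 0).
- move=> m i u; rewrite -(@syzygy_exact M m.+1 i u); split=> [fu0|].
    by apply: val_inj.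
  by move=> /= ->.
Qed.

Section RankOne.
Variable I : {set 'Z_n}.

Definition rank1_x i (u : {poly F}) : {poly F} := if i \in I then u else 'X * u.
Definition rank1_y i (u : {poly F}) : {poly F} := if i \in I then 'X * u else u.

Lemma rank1_x_linear i : linear (rank1_x i).
Proof. by rewrite /rank1_x => a u v; case: ifP; rewrite // mulrDr scalerAr. Qed.
HB.instance Definition _ i :=
  GRing.isLinear.Build F {poly F} {poly F} *:%R (rank1_x i) (@rank1_x_linear i).

Lemma rank1_y_linear i : linear (rank1_y i).
Proof. by rewrite /rank1_y => a u v; case: ifP; rewrite // mulrDr scalerAr. Qed.
HB.instance Definition _ i :=
  GRing.isLinear.Build F {poly F} {poly F} *:%R (rank1_y i) (@rank1_y_linear i).

Let U (_ : 'Z_n) : lmodType F := {poly F}.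

Lemma downE m (i : 'Z_n) : down m i = i - m%:R.
Proof. by elim: m => [|m /= ->]; rewrite ?subr0 // -addrA -opprD natr1. Qed.

Lemma rank1_xpath m i (u : {poly F}) :
  xpath (U := U) (fun i => rank1_x i : {linear U (i - 1) -> U i}) (m := m) (i := i) u
  = 'X^(\sum_(j < m) ((i - j%:R)%R \notin I)) * u.
Proof.
elim: m u => [|m IHm] u /=; first by rewrite big_ord0 mul1r.
rewrite IHm big_ord_recr /= exprD -mulrA downE /rank1_x.
by case: (_ \in I); rewrite ?mul1r ?expr1.
Qed.

Lemma rank1_ypath m i (u : {poly F}) :
  ypath (U := U) (fun i => rank1_y i : {linear U i -> U (i - 1)}) m (i := i) u
  = 'X^(\sum_(j < m) ((i - j%:R)%R \in I)) * u.
Proof.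
elim: m => [|m IHm] /=; first by rewrite big_ord0 mul1r.
rewrite IHm big_ord_recr /= addnC exprD -mulrA downE /rank1_y.
by case: (_ \in I); rewrite ?mul1r ?expr1.
Qed.

Hypotheses (n_gt1 : (1 < n)%N) (cardI : #|I| = k).

Lemma sum_window (P : pred 'Z_n) i : (\sum_(j < n) P (i - j%:R)%R = #|P|)%N.
Proof.
rewrite -sum1_card.
have eqn := Zp_cast n_gt1.
rewrite (reindex (fun j : 'Z_n => i - j)) /=; last first.
  by exists (fun j => i - j) => j _; rewrite subKr.
transitivity (\sum_(j < (Zp_trunc n).+2) P (i - j%:R)%R)%N.
  by move: (congr1 (fun m => \sum_(j < m) P (i - j%:R)%R)%N eqn) => /= ->.
rewrite [RHS]big_mkcond /=; apply: eq_bigr => j _.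
by rewrite natr_Zp unfold_in; case: (P _).
Qed.

Lemma rank1_path i (u : {poly F}) :
  Tagged U (xpath (fun i => rank1_x i : {linear U (i - 1) -> U i}) (i := i)
              (u : U (down k i)))
  = Tagged U (ypath (fun i => rank1_y i : {linear U i -> U (i - 1)}) (n - k)%N
              (u : U (down k i))).
Proof.
have le_kn : (k <= n)%N.
  by rewrite -cardI (leq_trans (max_card _)) // card_ord Zp_cast.
have n0 : n%:R = 0 :> 'Z_n by rewrite -[RHS](pchar_Zp n_gt1).
have Tag (a b : 'Z_n) (v w : {poly F}) : a = b -> v = w ->
  @Tagged _ a U v = @Tagged _ b U w by move=> -> ->.
apply: Tag; first by rewrite !downE -addrA -opprD -natrD subnKC // n0 subr0.
rewrite rank1_xpath rank1_ypath; congr ('X^_ * u).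
have: (\sum_(j < n) ((i - j%:R)%R \in I) = k)%N by rewrite (sum_window (mem I)).
rewrite -(big_mkord xpredT (fun j => ((i - j%:R)%R \in I) : nat)).
rewrite -{1}(subnKC le_kn) big_mkord big_split_ord /=.
have: (\sum_(j < k) ((i - j%:R)%R \in I) + \sum_(j < k) ((i - j%:R)%R \notin I) = k)%N.
  rewrite -big_split -[RHS]card_ord -sum1_card; apply: eq_bigr => j _ /=.
  by case: (_ \in I).
move=> sum_k sum_n; rewrite (addnI (etrans sum_k (esym sum_n))).
apply: eq_bigr => j _; rewrite downE.
by rewrite natrD opprD addrA.
Qed.

Definition rank1 : rep.
Proof.
refine (@Rep U (fun i => rank1_x i) (fun i => rank1_y i) _ rank1_path).
by move=> i u; rewrite /= /rank1_x /rank1_y; case: (i - 1 \in I); case: (i \in I).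
Defined.
End RankOne.
End Representations.

(* Main.v *)
From HB Require Import structures.
From mathcomp Require Import all_boot all_order all_algebra.
From mathcomp Require Import perm boolp ring.
Require Import Defs.
Set Implicit Arguments.
Unset Strict Implicit.
Unset Printing Implicit Defensive.
Import GRing.Theory.
Local Open Scope ring_scope.
Local Open Scope quotient_scope.

(** Put D = n - k. In every representation the composite of the arrows x once
    around the quiver is x^(n-k) x^k = x^(n-k) y^(n-k) = t^D. Following x from
    a lift of a generator therefore gives, for every surjection P -> L_I, a
    homomorphism L_I -> P whose composite with it is t^D
    ([section_up_to_power]). Hence t^D kills Ext^1(L_I, L_J), and the exact
    sequence 0 -> L_J -> L_J -> L_J / t^D L_J -> 0 identifies Ext^1(L_I, L_J)
    with Hom(L_I, L_J / t^D L_J) modulo the image of Hom(L_I, L_J).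

    A homomorphism L_I -> L_J / t^D L_J is multiplication by a polynomial s_i
    at each vertex i, subject to a_i s_i = b_i s_(i-1) modulo t^D, where a_i is
    t on J \ I, b_i is t on I \ J, and both are 1 elsewhere. Let Delta_IJ be
    the map sending s to (a_i s_i - b_i s_(i-1))_i. Its kernel is
    Hom(L_I, L_J), so writing Delta_IJ s = t^D c turns the quotient above into
    { c : t^D c lies in im Delta_IJ } / im Delta_IJ, the t^D-torsion of
    coker Delta_IJ ([ext_class]).

    Exchanging I and J exchanges a and b, so it remains to compare
    coker Delta_IJ with coker Delta_JI. Over F[t] a square matrix is equivalent
    to a diagonal one, hence to its transpose ([mx_equiv_trmx]), so
    coker Delta_IJ is isomorphic to the cokernel of the transpose. The latter
    has generators v_i and relations a_i v_i = b_i v_(i-1), whereas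
    coker Delta_JI has generators e_i and relations b_i e_i = a_(i+1) e_(i+1).
    Sending v_i to b_i e_i is an isomorphism between the two, because a_i = 1
    or b_i = 1 for every i ([coker_equiv_cyc_tr]). *)

(** * Diagonalisation over F[t] *)

Section Diagonalisation.
Variable F : fieldType.
Local Notation R := {poly F}.

Definition mx_equiv m (A B : 'M[R]_m) :=
  exists L U : 'M[R]_m, [/\ L \in unitmx, U \in unitmx & B = L *m A *m U].

Lemma mx_equiv_refl m (A : 'M[R]_m) : mx_equiv A A.
Proof. by exists 1%:M, 1%:M; rewrite !unitmx1 mul1mx mulmx1. Qed.

Lemma mx_equiv_trans m (A B C : 'M[R]_m) :
  mx_equiv A B -> mx_equiv B C -> mx_equiv A C.
Proof.
move=> [L [U [uL uU ->]]] [L' [U' [uL' uU' ->]]].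
by exists (L' *m L), (U *m U'); rewrite !unitmx_mul uL uU uL' uU' !mulmxA.
Qed.

Lemma mx_equiv_sym m (A B : 'M[R]_m) : mx_equiv A B -> mx_equiv B A.
Proof.
move=> [L [U [uL uU ->]]]; exists (invmx L), (invmx U).
by rewrite !unitmx_inv uL uU -!mulmxA mulmxV // mulmx1 mulKmx.
Qed.

Lemma mx_equiv_tr m (A B : 'M[R]_m) : mx_equiv A B -> mx_equiv A^T B^T.
Proof.
move=> [L [U [uL uU ->]]]; exists U^T, L^T.
by rewrite !unitmx_tr uL uU !trmx_mul mulmxA.
Qed.

Lemma mx_equiv_block m (a : 'M[R]_1) (A B : 'M[R]_m) : mx_equiv A B ->
  mx_equiv (block_mx a 0 0 A) (block_mx a 0 0 B).
Proof.
move=> [L [U [uL uU ->]]].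
exists (block_mx 1%:M 0 0 L), (block_mx 1%:M 0 0 U).
rewrite !unitmxE !det_lblock !det1 !mul1r -!unitmxE uL uU; split=> //.
by rewrite !mulmx_block ?(mulmx0, mul0mx, addr0, add0r, mul1mx, mulmx1).
Qed.

Lemma mx_equiv_lower m (a : 'M[R]_1) u (v w : 'M[R]_(m, 1)) (A : 'M[R]_m) :
  mx_equiv (block_mx a u v A) (block_mx a u (v + w *m a) (A + w *m u)).
Proof.
exists (block_mx 1%:M 0 w 1%:M), 1%:M.
rewrite unitmx1 unitmxE det_lblock !det1 mulr1 unitr1; split=> //.
rewrite mulmx1 mulmx_block !mul1mx !mul0mx !addr0.
by rewrite [w *m a + v]addrC [w *m u + A]addrC.
Qed.

(** Minimality over the whole equivalence class of the matrix, and not just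
    over its entries: a division with remainder performed by row operations
    then contradicts it at once, so no induction on degrees is needed. *)
Definition least_pivot m (A : 'M[R]_m) (a : R) :=
  forall B i j, mx_equiv A B -> B i j != 0 -> (size a <= size (B i j))%N.

Lemma least_pivot_exists m (A : 'M[R]_m.+1) : A != 0 ->
  exists B, [/\ mx_equiv A B, B 0 0 != 0 & least_pivot A (B 0 0)].
Proof.
move=> /matrix0Pn[i0 [j0 nzA]].
pose P s := `[< exists B i j, [/\ mx_equiv A B, B i j != 0 & size (B i j) = s] >].
have exP : exists s, P s.
  by exists (size (A i0 j0)); apply/asboolP; exists A, i0, j0; split=> //; apply: mx_equiv_refl.
case: (ex_minnP exP) => s /asboolP[B [i [j [AB nzB sB]]]] min_s.
exists (xrow 0 i (xcol 0 j B)).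
have eqB : xrow 0 i (xcol 0 j B) 0 0 = B i j by rewrite !mxE !tpermL.
rewrite eqB; split=> //.
  apply: mx_equiv_trans AB _; exists (tperm_mx 0 i), (tperm_mx 0 j).
  by rewrite xrowE xcolE !unitmx_perm mulmxA.
move=> C i' j' AC nzC; rewrite sB; apply: min_s; apply/asboolP.
by exists C, i', j'.
Qed.

Lemma least_pivot_trans m (A B : 'M[R]_m) a :
  mx_equiv A B -> least_pivot A a -> least_pivot B a.
Proof. by move=> AB pa C i j BC; apply: pa; apply: mx_equiv_trans AB BC. Qed.

Lemma least_pivot_tr m (A : 'M[R]_m) a : least_pivot A a -> least_pivot A^T a.
Proof.
move=> pa B i j AB nzB; have := pa B^T j i; rewrite mxE; apply=> //.
by rewrite -[A]trmxK; apply: mx_equiv_tr.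
Qed.

(** Row operations replace the first column below the pivot by its remainders
    modulo the pivot, which vanish by minimality. *)
Lemma least_pivot_clear m a u (v : 'M[R]_(m, 1)) (A : 'M[R]_m) : a != 0 ->
  least_pivot (block_mx a%:M u v A) a ->
  exists A', mx_equiv (block_mx a%:M u v A) (block_mx a%:M u 0 A').
Proof.
move=> nz_a pa; pose w : 'M[R]_(m, 1) := \col_i - (v i 0 %/ a).
exists (A + w *m u); have eqv := mx_equiv_lower a%:M u v w A.
suff w0 : v + w *m a%:M = 0 by rewrite w0 in eqv.
have wE i : (v + w *m a%:M) i 0 = v i 0 %% a.
  by rewrite mul_mx_scalar !mxE mulrN {1}(divp_eq (v i 0) a) mulrC [_ + _ %% _]addrC addrK.
apply/matrixP=> i j; rewrite ord1 wE mxE; apply/eqP; apply: contraT => nz_r.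
have := pa _ (rshift 1 i) (lshift m 0) eqv.
by rewrite block_mxEdl wE => /(_ nz_r); rewrite leqNgt ltn_modpN0.
Qed.

(** Clear the first column, then the first row by transposition, and recurse on
    the remaining block. *)
Lemma mx_equiv_diag m (A : 'M[R]_m) : exists2 D, mx_equiv A D & is_diag_mx D.
Proof.
elim: m A => [|m IHm] A.
  by exists A; [apply: mx_equiv_refl | apply/is_diag_mxP => -[]].
rewrite -[m.+1]/(1 + m)%N in A *.
have [->|nzA] := eqVneq A 0; first by exists 0; [apply: mx_equiv_refl | rewrite mx0_is_diag].
have [B [AB nzB pB]] : exists B : 'M_(1 + m), [/\ mx_equiv A B, B 0 0 != 0 & least_pivot A (B 0 0)].
  exact: least_pivot_exists nzA.
have {}pB := least_pivot_trans AB pB; set a := B 0 0 in nzB pB; move: AB pB; rewrite -[B]submxK.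
have -> : ulsubmx B = a%:M by rewrite [ulsubmx B]mx11_scalar !mxE !lshift0.
rewrite -/a => AB pB.
have [A1 eqv1] := least_pivot_clear nzB pB.
have := least_pivot_tr (least_pivot_trans eqv1 pB).
rewrite tr_block_mx tr_scalar_mx => /(least_pivot_clear nzB)[A2 /mx_equiv_tr eqv2].
rewrite !tr_block_mx !trmxK !tr_scalar_mx !trmx0 in eqv2.
have [D eqv3 diagD] := IHm A2^T.
exists (block_mx a%:M 0 0 D).
  exact: mx_equiv_trans AB (mx_equiv_trans eqv1 (mx_equiv_trans eqv2 (mx_equiv_block _ eqv3))).
by rewrite is_diag_block_mx // !eqxx diagD scalar_mx_is_diag.
Qed.

Lemma mx_equiv_trmx m (A : 'M[R]_m) : mx_equiv A A^T.
Proof.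
have [D AD /is_diag_mxP dD] := mx_equiv_diag A.
have tD : D^T = D.
  by apply/matrixP=> i j; rewrite mxE; have [->//|ij] := eqVneq i j; rewrite !dD // eq_sym.
apply: mx_equiv_trans (AD) _; rewrite -tD; apply: mx_equiv_tr; exact: mx_equiv_sym.
Qed.
End Diagonalisation.

(** * Quotients in linear correspondence *)

Section Correspondence.
Variables (R : nzRingType) (V V' : lmodType R).
Variables (S : {pred V}) (S' : {pred V'}).
Hypotheses (HS : submod_closed S) (HS' : submod_closed S').
Variable rel : V -> V' -> Prop.
Hypothesis rel_linear : forall a u v u' v',
  rel u u' -> rel v v' -> rel (a *: u + v) (a *: u' + v').
Hypothesis rel_total : forall v, exists v', rel v v'.
Hypothesis rel_onto : forall v', exists v, rel v v'.
Hypothesis rel_mem : forall v v', rel v v' -> (v \in S <-> v' \in S').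

Lemma pi_eqP (T : lmodType R) (A : {pred T}) (HA : submod_closed A) (u v : T) :
  \pi_(quotmod HA) u = \pi_(quotmod HA) v <-> u - v \in A.
Proof.
split=> [/eqP|uv]; first by rewrite -Quotient.idealrBE.
by apply/eqP; rewrite -Quotient.idealrBE.
Qed.

(** The class of v goes to the class of any v' related to it. Working with a
    relation avoids a linear choice of v', which would be awkward when v' is
    obtained from a lifting property. *)
Lemma quotmod_correspondence :
  exists phi : {linear quotmod HS -> quotmod HS'}, bijective phi.
Proof.
pose g v := sval (cid (rel_total v)); pose gP v : rel v (g v) := svalP (cid (rel_total v)).
pose phi (q : quotmod HS) : quotmod HS' := \pi_(quotmod HS') (g (repr q)).
have relB u v u' v' : rel u u' -> rel v v' -> rel (u - v) (u' - v').
  by move=> uu' vv'; rewrite -scaleN1r -[- v']scaleN1r ![_ + -1 *: _]addrC; apply: rel_linear.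
have phiE u u' : rel u u' -> phi (\pi_(quotmod HS) u) = \pi_(quotmod HS') u'.
  move=> uu'; apply/pi_eqP.
  by apply/(rel_mem (relB _ _ _ _ (gP _) uu'))/pi_eqP; rewrite reprK.
have phi_lin : linear phi.
  move=> a p q; rewrite -[p]reprK -[q]reprK.
  rewrite -[a *: _]/(quot_scale a _) pi_scale -Defs.pi_add.
  rewrite (phiE _ _ (gP (repr p))) (phiE _ _ (gP (repr q))).
  rewrite (phiE _ _ (rel_linear a (gP (repr p)) (gP (repr q)))).
  by rewrite Defs.pi_add -pi_scale.
pose phiL : {linear quotmod HS -> quotmod HS'} :=
  HB.pack phi (GRing.isLinear.Build R (quotmod HS) (quotmod HS') *:%R phi phi_lin).
exists phiL.
have h v' := cid (rel_onto v').
exists (fun q => \pi_(quotmod HS) (sval (h (repr q)))) => q /=.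
  rewrite -[RHS]reprK; apply/pi_eqP.
  rewrite /phi; set w := repr _.
  have := svalP (h w); set v := sval _ => vw.
  apply/(rel_mem (relB _ _ _ _ vw (gP _)))/pi_eqP.
  by rewrite /w reprK.
by rewrite (phiE _ _ (svalP (h (repr q)))) reprK.
Qed.
End Correspondence.

(** * Cokernels of cyclic bidiagonal matrices *)

Section Cokernels.
Variable R : comUnitRingType.

Definition in_im m (A : 'M[R]_m) (c : 'rV[R]_m) := exists r, c = r *m A.

Lemma in_im_linear m (A : 'M[R]_m) p c d :
  in_im A c -> in_im A d -> in_im A (p *: c + d).
Proof. by move=> [r ->] [s ->]; exists (p *: r + s); rewrite mulmxDl scalemxAl. Qed.

Lemma in_imB m (A : 'M[R]_m) c d : in_im A c -> in_im A d -> in_im A (c - d).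
Proof. by move=> [r ->] [s ->]; exists (r - s); rewrite mulmxBl. Qed.

Lemma in_imD m (A : 'M[R]_m) c d : in_im A c -> in_im A d -> in_im A (c + d).
Proof. by move=> [r ->] [s ->]; exists (r + s); rewrite mulmxDl. Qed.

Lemma in_imN m (A : 'M[R]_m) c : in_im A c -> in_im A (- c).
Proof. by move=> [r ->]; exists (- r); rewrite mulNmx. Qed.

(** Mutually inverse isomorphisms between the cokernels of A and A', lifted to
    the free modules of row vectors. *)
Definition coker_equiv m (A A' : 'M[R]_m) := exists f g : 'M[R]_m,
  [/\ forall c, in_im A c -> in_im A' (c *m f),
      forall c, in_im A' c -> in_im A (c *m g),
      forall c, in_im A (c *m f *m g - c)
    & forall c, in_im A' (c *m g *m f - c)].

Lemma coker_equiv_trans m (A B C : 'M[R]_m) :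
  coker_equiv A B -> coker_equiv B C -> coker_equiv A C.
Proof.
move=> [f [g [fP gP fgK gfK]]] [f' [g' [f'P g'P fgK' gfK']]].
exists (f *m f'), (g' *m g); split=> c.
- by rewrite mulmxA => /fP/f'P.
- by rewrite mulmxA => /g'P/gP.
- rewrite !mulmxA -[_ - _](subrKA (c *m f *m g)); apply: in_imD (fgK c).
  by rewrite -mulmxBl; apply/gP/fgK'.
- rewrite !mulmxA -[_ - _](subrKA (c *m g' *m f')); apply: in_imD (gfK' c).
  by rewrite -mulmxBl; apply/f'P/gfK.
Qed.

Variable n : nat.
Local Notation N := (Zp_trunc n).+2.
Implicit Types (a b : 'Z_n -> R).

(** Rows act on the right: [cyc_mx a b] is the map sending s to the vector
    a_i s_i - b_i s_(i-1), with indices modulo n. *)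
Definition cyc_mx a b : 'M[R]_N :=
  \matrix_(j, i) (a i *+ (j == i) - b i *+ (j == i - 1)).

Lemma sum_pick (f : 'Z_n -> R) (c : 'Z_n) (P : pred 'Z_n) : P =1 pred1 c ->
  \sum_j f j *+ P j = f c.
Proof.
move=> Pc; rewrite (bigD1 c) //= Pc /= eqxx big1 ?addr0 // => j.
by rewrite Pc /= => /negPf->.
Qed.

Lemma mul_cyc_mx a b (s : 'rV[R]_N) (i : 'Z_n) :
  (s *m cyc_mx a b) 0 i = a i * s 0 i - b i * s 0 (i - 1).
Proof.
rewrite mxE; under eq_bigr => j _ do rewrite mxE mulrBr !mulrnAr.
rewrite big_split sumrN /= (@sum_pick (fun j => s 0 j * a i) i) //.
by rewrite (@sum_pick (fun j => s 0 j * b i) (i - 1)) // mulrC [_ * b i]mulrC.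
Qed.

Lemma mul_cyc_mx_tr a b (s : 'rV[R]_N) (i : 'Z_n) :
  (s *m (cyc_mx a b)^T) 0 i = a i * s 0 i - b (i + 1) * s 0 (i + 1).
Proof.
rewrite mxE; under eq_bigr => j _ do rewrite !mxE mulrBr !mulrnAr.
rewrite big_split sumrN /= (@sum_pick (fun j => s 0 j * a j) i); last first.
  by move=> j; rewrite /= eq_sym.
rewrite (@sum_pick (fun j => s 0 j * b j) (i + 1)) 1?mulrC ?[_ * b _]mulrC // => j.
by rewrite /= eq_sym subr_eq.
Qed.

(** The maps are v_i |-> b_i e_i and, backwards, e_i |-> v_i if b_i = 1 and
    e_i |-> v_(i-1) otherwise; in the second case a_i = 1, so that the relation
    a_i v_i = b_i v_(i-1) makes v_(i-1) the quotient of v_i by b_i. *)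
Lemma coker_equiv_cyc_tr a b : (forall i, a i = 1 \/ b i = 1) ->
  coker_equiv (cyc_mx a b)^T (cyc_mx b a).
Proof.
move=> ab1; pose e (i : 'Z_n) := b i != 1.
have abP i : b i = 1 /\ e i = false \/ a i = 1 /\ e i = true.
  by rewrite /e; have [->|] := eqVneq; [left | case: (ab1 i) => -> nb1; [right|case/eqP: nb1]].
(* The witnesses r below are the coefficients of the relations used. *)
pose f : 'M[R]_N := diag_mx (\row_i b i).
pose g : 'M[R]_N :=
  \matrix_(i, j) (1 *+ (~~ e i && (i == j)) + 1 *+ (e i && (i == j + 1))).
have fE c (i : 'Z_n) : (c *m f) 0 i = b i * c 0 i.
  by rewrite mul_mx_diag !mxE mulrC.
have gE (c : 'rV_N) (j : 'Z_n) :
    (c *m g) 0 j = c 0 j *+ ~~ e j + c 0 (j + 1) *+ e (j + 1).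
  rewrite mxE; under eq_bigr => i _ do rewrite mxE mulrDr !mulrnAr !mulr1 -!mulnb !mulrnA.
  rewrite big_split /= (@sum_pick (fun i => c 0 i *+ ~~ e i) j) //.
  by rewrite (@sum_pick (fun i => c 0 i *+ e i) (j + 1)).
have rowE (c : 'rV_N) (h : 'Z_n -> R) (A : 'M_N) :
    (forall i, c 0 i = ((\row_i h i) *m A) 0 i) -> in_im A c.
  by move=> cE; exists (\row_i h i); apply/rowP.
exists f, g; split=> c.
- move=> [r ->]; apply: (rowE _ (fun i => - (b (i + 1) * r 0 (i + 1)))) => i.
  rewrite fE mul_cyc_mx_tr mul_cyc_mx !mxE subrK; ring.
- move=> [r ->].
  apply: (rowE _ (fun i => - (r 0 i *+ e i) - r 0 (i - 1) *+ ~~ e i)) => i.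
  rewrite gE !mul_cyc_mx mul_cyc_mx_tr !mxE addrK.
  by case: (abP i) => -[E1 E2]; case: (abP (i + 1)) => -[E3 E4]; rewrite ?E1 ?E2 ?E3 ?E4 /=; ring.
- apply: (rowE _ (fun i => - (c 0 i *+ e i))) => i.
  rewrite mxE gE !fE mul_cyc_mx_tr !mxE.
  by case: (abP i) => -[E1 E2]; case: (abP (i + 1)) => -[E3 E4]; rewrite ?E1 ?E2 ?E3 ?E4 /=; ring.
- apply: (rowE _ (fun i => c 0 (i + 1) *+ e (i + 1))) => i.
  rewrite mxE fE !gE mul_cyc_mx !mxE subrK.
  by case: (abP i) => -[E1 E2]; case: (abP (i + 1)) => -[E3 E4]; rewrite ?E1 ?E2 ?E3 ?E4 /=; ring.
Qed.
End Cokernels.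

(** If A^T = L A U with L and U invertible, then U carries the row space of A
    onto that of A^T. *)
Lemma coker_equiv_trmx (F : fieldType) m (A : 'M[{poly F}]_m) : coker_equiv A A^T.
Proof.
have [L [U [uL uU ->]]] := mx_equiv_trmx A.
exists U, (invmx U); split=> c.
- move=> [r ->]; exists (r *m invmx L).
  by rewrite !mulmxA mulmxKV.
- by move=> [r ->]; exists (r *m L); rewrite !mulmxA mulmxK.
- by exists 0; rewrite mulmxK // subrr mul0mx.
- by exists 0; rewrite mulmxKV // subrr mul0mx.
Qed.

(** * Factorisation and cokernels of representations *)

Section RepTheory.
Variables (F : fieldType) (n k : nat).
Local Notation rep := (rep F n k).

Lemma homB (M N : rep) (f : hom M N) i u v : f i (u - v) = f i u - f i v.
Proof. exact: linearB. Qed.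

Lemma hom_pact (M N : rep) (f : hom M N) i p (u : M i) : f i (pact p u) = pact p (f i u).
Proof. by apply: poly_act_morph => v; rewrite /= /taction hom_x hom_y. Qed.

Lemma rx_pact (M : rep) i p (u : M (i - 1)) : rx M i (pact p u) = pact p (rx M i u).
Proof. by apply: poly_act_morph => v; apply: taction_x. Qed.

Lemma ry_pact (M : rep) i p (u : M i) : ry M i (pact p u) = pact p (ry M i u).
Proof. by apply: poly_act_morph => v; apply: taction_y. Qed.

Lemma pactA (M : rep) i p q (u : M i) : pact p (pact q u) = pact (p * q) u.
Proof. exact: poly_actA. Qed.

Lemma pact1 (M : rep) i (u : M i) : pact 1 u = u.
Proof. exact: poly_act1. Qed.

Lemma pactX (M : rep) i (u : M i) : pact 'X u = taction u.
Proof. by rewrite -['X]mul1r /pact poly_act_mulX poly_act1. Qed.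

Lemma hom_scaleE (M N : rep) (f : hom M N) p i (u : M i) : (p *: f) i u = pact p (f i u).
Proof. by []. Qed.

Lemma hom_addE (M N : rep) (f g : hom M N) i (u : M i) : (f + g) i u = f i u + g i u.
Proof. by []. Qed.

Lemma hom_oppE (M N : rep) (f : hom M N) i (u : M i) : (- f) i u = - f i u.
Proof. by []. Qed.

Definition hom_id (M : rep) : hom M M.
Proof. by exists (fun i u => u). Defined.

(** The homomorphism a b^-1 c, which is well defined when c takes values in the
    image of b and a vanishes on the kernel of b. Both the maps induced on
    images along a resolution and the divisions by t^D below are of this form. *)
Lemma hom_factor (X Y Z N : rep) (a : hom X N) (b : hom X Y) (c : hom Z Y) :
    (forall i z, exists x, b i x = c i z) ->
    (forall i x, b i x = 0 -> a i x = 0) ->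
  exists psi : hom Z N, forall i z x, b i x = c i z -> psi i z = a i x.
Proof.
move=> cb ab.
pose s i z := sval (cid (cb i z)); pose sE i z : b i (s i z) = c i z := svalP (cid (cb i z)).
have psiE i z x : b i x = c i z -> a i (s i z) = a i x.
  by move=> bx; apply/eqP; rewrite -subr_eq0 -homB; apply/eqP/ab; rewrite homB sE bx subrr.
unshelve eexists (@Hom _ _ _ Z N (fun i z => a i (s i z)) _ _ _); last exact: psiE.
- move=> i p u v; rewrite -homZ -homD; apply: psiE.
  by rewrite homD homZ !sE homD homZ.
- by move=> i u; rewrite -hom_x; apply: psiE; rewrite hom_x sE hom_x.
- by move=> i u; rewrite -hom_y; apply: psiE; rewrite hom_y sE hom_y.
Qed.

Section Cokernel.
Variables (M N : rep) (f : hom M N).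

Definition im_pred i : {pred N i} := fun u => `[< exists v, f i v = u >].
Lemma im_closed i : submod_closed (@im_pred i).
Proof.
split=> [|a u v /asboolP[u' <-] /asboolP[v' <-]]; apply/asboolP.
  by exists 0; apply: hom_zero.
by exists (a *: u' + v'); rewrite homD homZ.
Qed.

(** The cokernel of a homomorphism, with the structure maps induced on the
    vertexwise quotients. It is used for L_J / t^D L_J. *)
Definition coker_sp i : lmodType F := quotmod (@im_closed i).

Lemma coker_eqP i (u v : N i) :
  \pi_(quotmod (@im_closed i)) u = \pi_(quotmod (@im_closed i)) v :> coker_sp i
  <-> exists w, f i w = u - v.
Proof. by rewrite pi_eqP; split=> /asboolP. Qed.

Definition coker_pi i (u : N i) : coker_sp i := \pi_(quotmod (@im_closed i)) u.

Lemma coker_piP i (q : coker_sp i) : exists u, coker_pi u = q.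
Proof. by exists (repr (q : quotmod _)); apply: reprK. Qed.

Lemma coker_pi_linear i : linear (@coker_pi i).
Proof. by move=> a u v; rewrite /coker_pi Defs.pi_add -pi_scale. Qed.
HB.instance Definition _ i :=
  GRing.isLinear.Build F (N i) (coker_sp i) *:%R (@coker_pi i) (@coker_pi_linear i).

Definition coker_x i (q : coker_sp (i - 1)) : coker_sp i :=
  coker_pi (rx N i (repr (q : quotmod _))).
Definition coker_y i (q : coker_sp i) : coker_sp (i - 1) :=
  coker_pi (ry N i (repr (q : quotmod _))).

Lemma coker_xE i (u : N (i - 1)) : coker_x (coker_pi u) = coker_pi (rx N i u).
Proof.
apply/coker_eqP; rewrite -linearB.
have /coker_eqP[w <-] : coker_pi (repr (coker_pi u : quotmod _)) = coker_pi u by apply: reprK.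
by exists (rx M i w); rewrite hom_x.
Qed.

Lemma coker_yE i (u : N i) : coker_y (coker_pi u) = coker_pi (ry N i u).
Proof.
apply/coker_eqP; rewrite -linearB.
have /coker_eqP[w <-] : coker_pi (repr (coker_pi u : quotmod _)) = coker_pi u by apply: reprK.
by exists (ry M i w); rewrite hom_y.
Qed.

Lemma coker_x_linear i : linear (@coker_x i).
Proof.
move=> a p q; have [u <-] := coker_piP p; have [v <-] := coker_piP q.
by rewrite -linearP !coker_xE !linearP.
Qed.
HB.instance Definition _ i := GRing.isLinear.Build F (coker_sp (i - 1)) (coker_sp i) *:%R
  (@coker_x i) (@coker_x_linear i).
Lemma coker_y_linear i : linear (@coker_y i).
Proof.
move=> a p q; have [u <-] := coker_piP p; have [v <-] := coker_piP q.
by rewrite -linearP !coker_yE !linearP.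
Qed.
HB.instance Definition _ i := GRing.isLinear.Build F (coker_sp i) (coker_sp (i - 1)) *:%R
  (@coker_y i) (@coker_y_linear i).

Let X i : {linear coker_sp (i - 1) -> coker_sp i} := @coker_x i.
Let Y i : {linear coker_sp i -> coker_sp (i - 1)} := @coker_y i.

Lemma coker_xpath m i (u : N (down m i)) : xpath X (coker_pi u) = coker_pi (xpath (rx N) u).
Proof. by elim: m u => //= m IHm u; rewrite coker_xE IHm. Qed.
Lemma coker_ypath m i (u : N i) : ypath Y m (coker_pi u) = coker_pi (ypath (ry N) m u).
Proof. by elim: m => //= m ->; rewrite coker_yE. Qed.

Lemma coker_comm i (q : coker_sp (i - 1)) : X (i - 1) (Y (i - 1) q) = Y i (X i q).
Proof. by have [u <-] := coker_piP q; rewrite /= coker_xE !coker_yE coker_xE rep_comm. Qed.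

Lemma coker_path i (q : coker_sp (down k i)) :
  Tagged coker_sp (xpath X q) = Tagged coker_sp (ypath Y (n - k)%N q).
Proof.
have [u <-] := coker_piP q; rewrite coker_xpath coker_ypath.
exact: (congr1 (fun z => Tagged coker_sp (coker_pi (tagged z))) (rep_path u)).
Qed.

Definition coker : rep := Rep coker_comm coker_path.

Definition coker_proj : hom N coker.
Proof.
exists coker_pi; first exact: coker_pi_linear.
  by move=> i u; rewrite -coker_xE.
by move=> i u; rewrite -coker_yE.
Defined.

Lemma coker_proj_surjective : hom_surjective coker_proj.
Proof. by move=> i q; apply: coker_piP. Qed.

Lemma coker_proj_eq i (u v : N i) :
  coker_proj i u = coker_proj i v <-> exists w, f i w = u - v.
Proof. exact: coker_eqP. Qed.
End Cokernel.
End RepTheory.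

(** * Going around the quiver *)

(** Any two proofs serve here, since equality on I is decidable. *)
Lemma ecastK (I : eqType) (P : I -> Type) (i j : I) (Eij : i = j) (Eji : j = i) (u : P i) :
  ecast j (P j) Eji (ecast j (P j) Eij u) = u.
Proof. by move: Eji; case: j / Eij => Eji; rewrite eq_axiomK. Qed.

Section Loop.
Variables (F : fieldType) (n k : nat) (M : rep F n k).
Local Notation U := (rsp M).
Local Notation T := {i : 'Z_n & M i}.

(** The arrows x and y as endomaps of the total space of M. Paths of any length
    are then iterates, and no transport along identities between vertices is
    needed to compose them. *)
Definition stepx (p : T) : T := Tagged U (rx M (tag p + 1)
  (ecast i (M i) (esym (addrK 1 (tag p))) (tagged p))).
Definition stepy (p : T) : T := Tagged U (ry M (tag p) (tagged p)).
Definition tpow a (p : T) : T := Tagged U (pact a (tagged p)).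

Lemma stepxE i (u : M (i - 1)) : stepx (Tagged U u) = Tagged U (rx M i u).
Proof.
suff step_cast j (E : i - 1 = j) :
    stepx (Tagged U (ecast j (M j) E u)) = Tagged U (rx M i u).
  exact: (step_cast _ erefl).
have Ei : j + 1 = i by rewrite -E subrK.
move: E u; case: i / Ei => E u.
by rewrite /stepx /= ecastK.
Qed.

Lemma Tagged_cast i j (u : M j) : j = i - 1 -> exists v : M (i - 1), Tagged U v = Tagged U u.
Proof. by move=> Ej; exists (ecast j (M j) Ej u); case: _ / Ej. Qed.

Lemma total_targetP (p : T) : exists i (u : M (i - 1)), p = Tagged U u.
Proof.
case: p => j u; have Ej : j = (j + 1) - 1 by rewrite addrK.
by exists (j + 1); have [v Ev] := Tagged_cast u Ej; exists v.
Qed.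

Lemma stepxy p : stepx (stepy p) = tpow 'X p.
Proof. by case: p => i u; rewrite /stepy stepxE /tpow /= pactX. Qed.

Lemma tpow_stepx a p : stepx (tpow a p) = tpow a (stepx p).
Proof. by have [i [u ->]] := total_targetP p; rewrite !stepxE [in LHS]/= rx_pact. Qed.

Lemma iter_stepx m i (u : M (down m i)) :
  iter m stepx (Tagged U u) = Tagged U (xpath (rx M) u).
Proof. by elim: m u => // m IHm u; rewrite iterSr stepxE IHm. Qed.

Lemma iter_stepy m i (u : M i) :
  iter m stepy (Tagged U u) = Tagged U (ypath (ry M) m u).
Proof. by elim: m => // m IHm; rewrite iterS IHm. Qed.

Lemma iter_stepxk p : iter k stepx p = iter (n - k) stepy p.
Proof.
case: p => j u; have [i Ej] : exists i, j = down k i.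
  by exists (j + k%:R); rewrite downE addrK.
by move: u; rewrite Ej => u; rewrite iter_stepx iter_stepy rep_path.
Qed.

Lemma iter_stepxy m p : iter m stepx (iter m stepy p) = tpow 'X^m p.
Proof.
elim: m p => [|m IHm] p; first by case: p => i u; rewrite /tpow /= pact1.
rewrite iterSr iterS stepxy.
have -> : forall a q, iter m stepx (tpow a q) = tpow a (iter m stepx q).
  by move=> a q; elim: (m) => //= m' ->; rewrite tpow_stepx.
by rewrite IHm /tpow /= pactA exprS.
Qed.

(** One turn around the quiver is x^(n-k) x^k = x^(n-k) y^(n-k) = t^(n-k). *)
Lemma iter_stepxn p : (k <= n)%N -> iter n stepx p = tpow 'X^(n - k) p.
Proof.
move=> le_kn; have En : n = ((n - k) + k)%N by rewrite subnK.
rewrite (congr1 (fun m => iter m stepx p) En : iter n stepx p = _).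
by rewrite iterD iter_stepxk iter_stepxy.
Qed.

Hypotheses (n_gt1 : (1 < n)%N) (le_kn : (k <= n)%N).

(** The factor picked up when the arrow x into i closes the loop at 0. *)
Definition winding (i : 'Z_n) : {poly F} := if i == 0 then 'X^(n - k) else 1.

(** The elements e_i = x^i u, for 0 <= i < n. *)
Lemma path_family (u : M 0) : exists e : forall i, M i,
  e 0 = u /\ forall i : 'Z_n, rx M i (e (i - 1)) = pact (winding i) (e i).
Proof.
pose p : T := Tagged U u.
have tag_iter m : tag (iter m stepx p) = m%:R.
  by elim: m => // m IHm; rewrite iterS /= IHm -natr1.
have ex_e (i : 'Z_n) : exists v : M i, Tagged U v = iter i stepx p.
  have := tag_iter (i : nat); rewrite natr_Zp.
  by case: (iter _ _ _) => j v /= Ej; case: i / Ej; exists v.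
pose e i := sval (cid (ex_e i)).
have eP i : Tagged U (e i) = iter i stepx p := svalP (cid (ex_e i)).
have inj i (v w : M i) : Tagged U v = Tagged U w -> v = w.
  by move/eqP; rewrite eq_Tagged => /eqP.
have e0 : e 0 = u by apply: (inj); rewrite eP.
exists e; split=> // i.
apply: (inj); rewrite -stepxE eP -iterS /winding.
have [->|nz_i] := eqVneq i 0.
  have -> : (val (0 - 1 : 'Z_n)).+1 = n.
    by rewrite sub0r /= modn_small ?Zp_cast // subn1 prednK // ltnW.
  by rewrite iter_stepxn // e0.
rewrite pact1 eP; apply: (congr1 (fun m => iter m stepx p)).
have [m Em] : exists m, i = m.+1 :> nat by exists i.-1; rewrite prednK // lt0n.
have -> : i - 1 = m%:R by rewrite -[i]natr_Zp Em -natr1 addrK.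
rewrite val_Zp_nat // modn_small //.
by rewrite -[n in (_ < n)%N](Zp_cast n_gt1) ltnW // -Em ltn_ord.
Qed.
End Loop.

(** * Multiplication by a power of t on a rank one module *)

Section RankOneFacts.
Variables (F : fieldType) (n k : nat) (n_gt1 : (1 < n)%N).
Variables (I : {set 'Z_n}) (cardI : #|I| = k).
Local Notation L := (rank1 F n_gt1 cardI).

Definition xcoef (i : 'Z_n) : {poly F} := if i \in I then 1 else 'X.
Definition ycoef (i : 'Z_n) : {poly F} := if i \in I then 'X else 1.

Lemma xycoef i : xcoef i * ycoef i = 'X.
Proof. by rewrite /xcoef /ycoef; case: ifP; rewrite ?mul1r ?mulr1. Qed.

Lemma rank1_rx i (u : {poly F}) : rx L i u = xcoef i * u.
Proof. by rewrite /= /rank1_x /xcoef; case: ifP; rewrite ?mul1r. Qed.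

Lemma rank1_ry i (u : {poly F}) : ry L i u = ycoef i * u.
Proof. by rewrite /= /rank1_y /ycoef; case: ifP; rewrite ?mul1r. Qed.

Lemma rank1_pact i p (u : {poly F}) : pact (M := L) (i := i) p u = p * u.
Proof.
elim/poly_ind: p => [|p c IHp]; first by rewrite mul0r /pact /poly_act size_poly0 big_ord0.
rewrite /pact poly_actDl poly_act_mulX poly_actC -/(pact _ _) IHp.
by rewrite /= /taction rank1_ry rank1_rx mulrA xycoef mulrDl mul_polyC -mulrA mulrCA.
Qed.

Lemma rank1_homE (N : rep F n k) (h : hom L N) i (u : {poly F}) :
  h i u = pact u (h i (1 : {poly F})).
Proof. by rewrite -hom_pact rank1_pact mulr1. Qed.

Lemma card_le_n : (k <= n)%N.
Proof. by rewrite -cardI (leq_trans (max_card _)) // card_ord Zp_cast. Qed.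

Lemma pactDl (N : rep F n k) i p q (u : N i) : pact (p + q) u = pact p u + pact q u.
Proof. exact: poly_actDl. Qed.
Lemma pactZl (N : rep F n k) i c p (u : N i) : pact (c *: p) u = c *: pact p u.
Proof. by rewrite -mul_polyC /pact poly_act_C_mul. Qed.

(** Lift 1 at the vertex 0 to u in P, and let e_i = x^i u. Then g e_i is a
    divisor b_i of t^(n-k), as the remaining arrows x lead from it to
    t^(n-k) at the vertex 0, and tau sends 1 at the vertex i to
    (t^(n-k) / b_i) e_i. The scaling makes tau commute with x. As P may have
    torsion, x cannot be cancelled to deduce the same for y; instead
    t^(n-k) / b_i is a multiple of the factor w_i in x e_(i-1) = w_i e_i, and y (w_i e_i) = y x e_(i-1) = t e_(i-1). *)
Lemma section_up_to_power (P : rep F n k) (g : hom P L) : hom_surjective g ->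
  exists tau : hom L P, forall i (u : {poly F}), g i (tau i u) = 'X^(n - k) * u.
Proof.
move=> g_surj; have [u0 gu0] := g_surj 0 (1 : {poly F}).
have [e [e0 eE]] := path_family n_gt1 card_le_n u0.
pose w (i : 'Z_n) : {poly F} := winding F k i.
pose b i : {poly F} := g i (e i).
have bE i : xcoef i * b (i - 1) = w i * b i.
  by rewrite /b -(rank1_pact i (w i)) -hom_pact -eE hom_x rank1_rx.
have b0 : b 0 = 1 by rewrite /b e0.
have b_dvd i : b i %| 'X^(n - k).
  (* Backwards along the loop, starting from the arrow that closes it at 0. *)
  have dvd m : b (- m.+1%:R) %| 'X^(n - k).
    elim: m => [|m IHm].
      have -> : 'X^(n - k) = xcoef 0 * b (0 - 1) by rewrite bE b0 mulr1 /w /winding eqxx.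
      by rewrite sub0r dvdp_mull.
    have : b (- m.+2%:R) %| w (- m.+1%:R) * b (- m.+1%:R).
      by rewrite -bE -natr1 opprD dvdp_mull.
    rewrite {1}/w /winding; case: eqP => [->|_]; first by rewrite b0 mulr1.
    by rewrite mul1r => /dvdp_trans; apply.
  have -> : i = - (nat_of_ord (- i - 1)%R).+1%:R by rewrite -natr1 natr_Zp subrK opprK.
  exact: dvd.
have nzX m : 'X^m != 0 :> {poly F} by rewrite expf_neq0 // polyX_eq0.
have nzb i : b i != 0 by apply: contraTneq (b_dvd i) => ->; rewrite dvd0p.
pose b' i := 'X^(n - k) %/ b i.
have b'K i : b' i * b i = 'X^(n - k) by apply: divpK.
have b'E i : b' (i - 1) * w i = xcoef i * b' i.
  apply: (mulIf (nzb (i - 1))); rewrite mulrAC b'K.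
  by rewrite -(b'K i) [RHS]mulrAC bE; ring.
have b'r i : exists r, b' i = w i * r /\ b' (i - 1) = xcoef i * r.
  have := b'E i; rewrite /w /winding; case: eqP => [-> Eb|_ Eb].
    have Eb0 : b' 0 = 'X^(n - k) by rewrite -(b'K 0) b0 mulr1.
    exists 1; rewrite !mulr1; split=> //.
    by apply: (mulIf (nzX (n - k)%N)); rewrite Eb Eb0.
  by exists (b' i); rewrite mul1r -Eb mulr1.
unshelve eexists (@Hom _ _ _ L P (fun i (u : {poly F}) => pact (b' i * u) (e i)) _ _ _).
- by move=> i c u v /=; rewrite mulrDr -scalerAr pactDl pactZl.
- move=> i u; rewrite rank1_rx rx_pact eE pactA; congr (pact _ _).
  by rewrite mulrA [_ * xcoef _]mulrC -b'E /w; ring.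
- move=> i u; rewrite rank1_ry ry_pact; have [r [-> ->]] := b'r i.
  rewrite (_ : w i * r * u = r * u * w i); last by ring.
  rewrite -pactA -ry_pact -eE.
  rewrite -rep_comm -/(taction _) -pactX pactA -(xycoef i); congr (pact _ _); ring.
- move=> i u /=; rewrite hom_pact rank1_pact -(b'K i) /b; ring.
Qed.
End RankOneFacts.

(** * Ext of rank one modules as torsion in a cokernel *)

Section ExtRankOne.
Variables (F : fieldType) (n k : nat) (n_gt1 : (1 < n)%N).
Variables (I J : {set 'Z_n}) (cardI : #|I| = k) (cardJ : #|J| = k).
Local Notation M := (rank1 F n_gt1 cardI).
Local Notation N := (rank1 F n_gt1 cardJ).
Local Notation D := (n - k)%N.
Local Notation V := 'rV[{poly F}]_(Zp_trunc n).+2.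

(** The factors a = [defect I J] and b = [defect J I] are what remains of the
    action of x on L_I and on L_J once their common factor is removed; for y
    the two are exchanged. *)
Definition defect (A B : {set 'Z_n}) (i : 'Z_n) : {poly F} :=
  if (i \in B) && (i \notin A) then 'X else 1.

(** The matrix Delta_IJ, whose kernel is Hom(L_I, L_J). *)
Definition hom_mx := cyc_mx (defect I J) (defect J I).

Lemma defect_x i : exists2 c, c != 0 &
  xcoef F I i = c * defect I J i /\ xcoef F J i = c * defect J I i.
Proof.
exists (if (i \in I) || (i \in J) then 1 else 'X); first by case: ifP; rewrite ?oner_eq0 ?polyX_eq0.
by rewrite /xcoef /defect; case: (i \in I); case: (i \in J); rewrite /= ?mul1r ?mulr1.
Qed.

Lemma defect_y i : exists c, ycoef F J i = c * defect I J i /\ ycoef F I i = c * defect J I i.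
Proof.
exists (if (i \in I) && (i \in J) then 'X else 1).
by rewrite /ycoef /defect; case: (i \in I); case: (i \in J); rewrite /= ?mul1r ?mulr1.
Qed.

(** At each arrow the common factor of the two actions is 1 for x or for y, and
    that condition is the conclusion. *)
Lemma defect_dvd i (q u v : {poly F}) :
  q %| xcoef F I i * u - xcoef F J i * v -> q %| ycoef F J i * u - ycoef F I i * v ->
  q %| defect I J i * u - defect J I i * v.
Proof.
by rewrite /xcoef /ycoef /defect; case: (i \in I); case: (i \in J); rewrite /= ?mul1r.
Qed.

Lemma polyXn_neq0 m : 'X^m != 0 :> {poly F}.
Proof. by rewrite expf_neq0 // polyX_eq0. Qed.

Lemma row_scaleI (u v : V) m : 'X^m *: u = 'X^m *: v -> u = v.
Proof.
move=> uv; apply/rowP=> i; apply: (mulfI (polyXn_neq0 m)).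
by have := congr1 (fun w : V => w 0 i) uv; rewrite !mxE.
Qed.

Lemma hom_of_hom_mx_ker (h : V) : h *m hom_mx = 0 ->
  exists g : hom M N, forall i (u : {poly F}), g i u = h 0 i * u.
Proof.
move=> h0; have hE i : defect I J i * h 0 i = defect J I i * h 0 (i - 1).
  by apply/eqP; rewrite -subr_eq0 -mul_cyc_mx h0 mxE.
unshelve eexists (@Hom _ _ _ M N (fun i (u : {poly F}) => h 0 i * u) _ _ _).
- by move=> i c u v /=; rewrite mulrDr scalerAr.
- move=> i u; rewrite !rank1_rx; have [c _ [-> ->]] := defect_x i.
  by rewrite mulrCA -!mulrA [defect I J i * _]mulrA hE; ring.
- move=> i u; rewrite !rank1_ry; have [c [-> ->]] := defect_y i.
  by rewrite -!mulrA [defect I J i * _]mulrA hE; ring.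
- by [].
Qed.

Lemma hom_mx_ker_of_hom (g : hom M N) : (\row_i (g i (1 : {poly F}) : {poly F})) *m hom_mx = 0.
Proof.
apply/rowP=> i; rewrite mul_cyc_mx !mxE; have [c nzc [EI EJ]] := defect_x i.
apply: (mulfI nzc); rewrite mulr0 mulrBr !mulrA -EI -EJ.
have := @hom_x _ _ _ _ _ g i (1 : {poly F}); rewrite !rank1_rx mulr1 rank1_homE rank1_pact => ->.
by rewrite subrr.
Qed.

Section Classes.
Variable P : proj_resolution M.

(** The cocycle f and the vector c represent the same class. Since t^D f is the
    coboundary of psi, the reduction of psi modulo t^D factors through L_I, where
    it is multiplication by the polynomials s_i; the vector c measures how far s
    is from a homomorphism L_I -> L_J. *)
Definition ext_class (f : hom (P 1) N) (c : V) := exists (psi : hom (P 0) N) (s : V),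
  [/\ hom_comp psi (rdiff P 0) = 'X^D *: f,
      forall i (u : P 0 i), exists w : {poly F}, psi i u = s 0 i * raug P i u + 'X^D * w
    & s *m hom_mx = 'X^D *: c].

Lemma ext_class_linear p f g c d :
  ext_class f c -> ext_class g d -> ext_class (p *: f + g) (p *: c + d).
Proof.
move=> [psi [s [fE sP cE]]] [psi' [s' [gE sP' dE]]].
exists (p *: psi + psi'), (p *: s + s'); split.
- by rewrite hom_compP fE gE scalerDr !scalerA mulrC.
- move=> i u; have [w Ew] := sP i u; have [w' Ew'] := sP' i u.
  exists (p * w + w'); rewrite hom_addE hom_scaleE rank1_pact Ew Ew' !mxE /=; ring.
- by rewrite mulmxDl -scalemxAl cE dE scalerDr !scalerA mulrC.
Qed.

Lemma hom_divXn (Z : rep F n k) (h : hom Z N) :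
    (forall i u, exists w : {poly F}, h i u = 'X^D * w) ->
  exists g : hom Z N, h = 'X^D *: g.
Proof.
move=> h_dvd; pose q : hom N N := 'X^D *: hom_id N.
have qE i (x : {poly F}) : q i x = 'X^D * x by rewrite hom_scaleE rank1_pact.
have [||g gE] := @hom_factor F n k N N Z N (hom_id N) q h.
- by move=> i z; have [w ->] := h_dvd i z; exists w; rewrite qE.
- by move=> i x; rewrite qE => /eqP; rewrite mulf_eq0 (negPf (polyXn_neq0 _)) => /eqP.
exists g; apply: homP => i z; have [w Ew] := h_dvd i z.
by rewrite hom_scaleE rank1_pact (gE i z w) ?qE.
Qed.

Lemma hom_scaleI (Z : rep F n k) (f g : hom Z N) : 'X^D *: f = 'X^D *: g -> f = g.
Proof.
move=> fg; apply: homP => i u; have := congr1 (fun h : hom Z N => h i u) fg.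
by rewrite !hom_scaleE !rank1_pact => /(mulfI (polyXn_neq0 _)).
Qed.

Lemma raug_exactP i (u : P 0 i) : raug P i u = 0 <-> exists v, rdiff P 0 i v = u.
Proof. exact: raug_exact. Qed.

Lemma rdiff_exactP i (u : P 1 i) : rdiff P 0 i u = 0 <-> exists v, rdiff P 1 i v = u.
Proof. exact: rdiff_exact. Qed.

Lemma raug_onto i v : exists u, raug P i u = v.
Proof. exact: raug_surjective. Qed.

Lemma raug_diff i v : raug P i (rdiff P 0 i v) = 0.
Proof. by apply/raug_exactP; exists v. Qed.

(** With tau such that the augmentation composed with tau is t^D, the map
    u |-> t^D u - tau (aug u) takes values in the image of P_1, and psi is its
    composite with the map induced by f on that image. *)
Lemma ext_class_total (f : hom (P 1) N) :
  hom_comp f (rdiff P 1) = 0 -> exists c, ext_class f c.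
Proof.
move=> f0.
have [tau tauE] := section_up_to_power raug_onto.
pose c0 : hom (P 0) (P 0) := 'X^D *: hom_id (P 0) - hom_comp tau (raug P).
have c0E i u : c0 i u = pact 'X^D u - tau i (raug P i u) by [].
have [||psi psiE] := hom_factor (a := f) (b := rdiff P 0) (c := c0).
- move=> i u; apply/raug_exactP.
  by rewrite c0E homB hom_pact tauE rank1_pact subrr.
- move=> i v /rdiff_exactP[w <-].
  by rewrite -[LHS]/(hom_comp f (rdiff P 1) i w) f0.
have psi_d i v : psi i (rdiff P 0 i v) = 'X^D * f i v.
  rewrite (psiE _ _ (pact 'X^D v)) ?hom_pact ?rank1_pact //.
  by rewrite c0E raug_diff (hom_zero tau) subr0.
(* Evaluating psi at lifts of the generator 1 yields the polynomials s_i. *)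
pose eps i := sval (cid (@raug_onto i (1 : {poly F}))).
have epsE i : raug P i (eps i) = (1 : {poly F}) := svalP (cid (@raug_onto i (1 : {poly F}))).
pose s : V := \row_i (psi i (eps i) : {poly F}).
have sE i : s 0 i = psi i (eps i) by rewrite mxE.
have psi_s i u : exists w : {poly F}, psi i u = s 0 i * raug P i u + 'X^D * w.
  have [v Ev] : exists v, rdiff P 0 i v = u - pact (raug P i u : {poly F}) (eps i).
    by apply/raug_exactP; rewrite homB hom_pact epsE rank1_pact mulr1 subrr.
  exists (f i v); rewrite -psi_d Ev homB hom_pact rank1_pact sE.
  by rewrite [_ * (raug P i u : {poly F})]mulrC addrC subrK.
have sdvd i : 'X^D %| (s *m hom_mx) 0 i.
  rewrite mul_cyc_mx; apply: defect_dvd.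
    have [w] := psi_s i (rx _ i (eps (i - 1))).
    rewrite !hom_x epsE !rank1_rx -sE mulr1 => Ew.
    rewrite Ew [xcoef F I i * _]mulrC opprD addrA subrr sub0r dvdpNr.
    exact: dvdp_mulIl.
  have [w] := psi_s (i - 1) (ry _ i (eps i)).
  rewrite !hom_y epsE !rank1_ry -sE mulr1 => ->.
  by rewrite [ycoef F I i * _]mulrC addrAC subrr add0r dvdp_mulIl.
exists (\row_i ((s *m hom_mx) 0 i %/ 'X^D)), psi, s; split=> //.
- by apply: homP => i v; rewrite hom_scaleE rank1_pact -psi_d.
- by apply/rowP=> i; rewrite 2![in RHS]mxE mulrC divpK.
Qed.

Lemma ext_class_torsion f c : ext_class f c -> in_im hom_mx ('X^D *: c).
Proof. by move=> [psi [s [_ _ <-]]]; exists s. Qed.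

(** Such a c gives a homomorphism phi from L_I to the cokernel of t^D on L_J.
    Projectivity of P_0 lifts phi composed with the augmentation to
    psi : P_0 -> L_J; on the image of P_1 it is divisible by t^D, and f is the
    quotient. *)
Lemma ext_class_onto c : in_im hom_mx ('X^D *: c) ->
  exists2 f, hom_comp f (rdiff P 1) = 0 & ext_class f c.
Proof.
move=> [s sE].
have sEi i : defect I J i * s 0 i - defect J I i * s 0 (i - 1) = 'X^D * c 0 i.
  by rewrite -mul_cyc_mx -/hom_mx -sE mxE.
pose q : hom N N := 'X^D *: hom_id N.
have qE i (x : {poly F}) : q i x = 'X^D * x by rewrite hom_scaleE rank1_pact.
have piE i (u v w : {poly F}) : u - v = 'X^D * w -> coker_proj q i u = coker_proj q i v.
  by move=> uv; apply/coker_proj_eq; exists w; rewrite qE.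
unshelve epose (phi :=
  @Hom _ _ _ M (coker q) (fun i (u : {poly F}) => coker_proj q i (s 0 i * u)) _ _ _).
- by move=> i a u v /=; rewrite mulrDr -scalerAr linearP.
- move=> i u; rewrite -hom_x !rank1_rx; have [d _ [-> ->]] := defect_x i.
  apply: (piE _ _ _ (d * c 0 i * u)).
  by transitivity (d * u * ('X^D * c 0 i)); [rewrite -sEi|]; ring.
- move=> i u; rewrite -hom_y !rank1_ry; have [d [-> ->]] := defect_y i.
  apply: (piE _ _ _ (- (d * c 0 i * u))).
  by transitivity (- (d * u * ('X^D * c 0 i))); [rewrite -sEi|]; ring.
have [psi psiE] := @rterm_projective _ _ _ _ P 0 _ _ _ (hom_comp phi (raug P))
  (@coker_proj_surjective _ _ _ _ _ q).
have psiP i (u : P 0 i) : exists w : {poly F}, psi i u = s 0 i * raug P i u + 'X^D * w.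
  have /coker_proj_eq[w] :
      coker_proj q i (psi i u) = coker_proj q i (s 0 i * raug P i u : {poly F}).
    exact: (congr1 (fun h : hom (P 0) (coker q) => h i u) psiE).
  by rewrite qE => Ew; exists w; rewrite Ew addrC subrK.
have [i v|f fE] := @hom_divXn _ (hom_comp psi (rdiff P 0)).
  by have [w Ew] := psiP i (rdiff P 0 i v); exists w; rewrite /= Ew raug_diff mulr0 add0r.
exists f; last by exists psi, s.
apply: hom_scaleI; apply: homP => i v; rewrite scaler0.
have dd : rdiff P 0 i (rdiff P 1 i v) = 0 by apply/rdiff_exactP; exists v.
rewrite -[LHS]/(('X^D *: f) i (rdiff P 1 i v)) -fE /=.
by rewrite dd (hom_zero psi).
Qed.

(** If f is the coboundary of g, then psi - t^D g factors through a homomorphism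
    h : L_I -> L_J, so s is h modulo t^D and c is the image of (s - h) / t^D.
    Conversely, if c is the image of r, then s - t^D r is a homomorphism
    h : L_I -> L_J, and f is the coboundary of (psi - h aug) / t^D. *)
Lemma ext_class_coboundary f c : ext_class f c ->
  (exists g : hom (P 0) N, f = hom_comp g (rdiff P 0)) <-> in_im hom_mx c.
Proof.
move=> [psi [s [fE sP cE]]]; split=> [[g gE]|[r rE]].
- have [i z|i x|h hE] := hom_factor (a := psi - 'X^D *: g) (b := raug P) (c := hom_id M).
  + exact: raug_onto.
  + move/raug_exactP=> [v <-]; rewrite hom_addE hom_oppE.
    rewrite -[psi i _]/(hom_comp psi (rdiff P 0) i v) fE gE.
    by rewrite !hom_scaleE /= subrr.
  have h1 i : exists w : {poly F}, h i (1 : {poly F}) = s 0 i + 'X^D * w.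
    have [u Eu] := @raug_onto i (1 : {poly F}).
    have [w Ew] := sP i u; exists (w - g i u).
    rewrite (hE i _ u Eu) hom_addE hom_oppE hom_scaleE rank1_pact Ew Eu mulr1; ring.
  pose w i := sval (cid (h1 i)); have wE i : _ = _ + _ * w i := svalP (cid (h1 i)).
  exists (- \row_i w i); apply: (@row_scaleI _ _ D).
  rewrite -cE scalemxAl -[LHS]subr0 -(hom_mx_ker_of_hom h) -mulmxBl; congr (_ *m _).
  by apply/rowP=> i; rewrite !mxE wE opprD addrA subrr sub0r mulrN.
- have [|g gE] := hom_of_hom_mx_ker (h := s - 'X^D *: r).
    by rewrite mulmxBl cE -scalemxAl -rE subrr.
  have [i u|g' g'E] := @hom_divXn _ (psi - hom_comp g (raug P)).
    have [w Ew] := sP i u; exists (w + r 0 i * raug P i u).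
    rewrite hom_addE hom_oppE /= gE Ew !mxE; ring.
  exists g'; apply: hom_scaleI; rewrite -fE; apply: homP => i v.
  rewrite -[RHS]/(('X^D *: g') i (rdiff P 0 i v)) -g'E hom_addE hom_oppE /=.
  by rewrite raug_diff (hom_zero g) subr0.
Qed.
End Classes.
End ExtRankOne.

(** * Symmetry *)

Lemma coker_equiv_hom_mx (F : fieldType) n (I J : {set 'Z_n}) :
  coker_equiv (hom_mx F I J) (hom_mx F J I).
Proof.
apply: coker_equiv_trans (coker_equiv_trmx _) (coker_equiv_cyc_tr _) => i.
by rewrite /defect; case: (i \in I); case: (i \in J); rewrite /= ?andbF; [left|left|right|left].
Qed.

Section Symmetry.
Variables (F : fieldType) (n k : nat) (n_gt1 : (1 < n)%N).
Variables (I J : {set 'Z_n}) (cardI : #|I| = k) (cardJ : #|J| = k).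
Local Notation LI := (rank1 F n_gt1 cardI).
Local Notation LJ := (rank1 F n_gt1 cardJ).
Variables (P : proj_resolution LI) (Q : proj_resolution LJ).

(** The isomorphism of cokernels preserves t^D-torsion, hence induces a linear
    correspondence between cocycles on the two resolutions. *)
Lemma Ext1_rank1_symmetric : exists phi : {linear Ext1 P LJ -> Ext1 Q LI}, bijective phi.
Proof.
have [f [g [fP gP fgK gfK]]] := coker_equiv_hom_mx F I J.
pose rel (x : submod (cocycle_closed P LJ)) (y : submod (cocycle_closed Q LI)) :=
  exists c d, [/\ ext_class (val x) c, ext_class (val y) d & in_im (hom_mx F J I) (d - c *m f)].
apply: (@quotmod_correspondence _ _ _ _ _ _ _ rel).
- move=> a x x' y y' [c [d [xc yd cd]]] [c' [d' [xc' yd' cd']]].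
  exists (a *: c + c'), (a *: d + d'); split; try exact: ext_class_linear.
  rewrite mulmxDl opprD addrACA -scalemxAl -scalerBr; exact: in_im_linear.
- move=> x; have /asboolP/ext_class_total[c xc] := valP x.
  have [|y /asboolP y0 yd] := @ext_class_onto F n k n_gt1 J I cardJ cardI Q (c *m f).
    by rewrite scalemxAl; apply/fP/(ext_class_torsion xc).
  by exists (Sub y y0), c, (c *m f); split=> //; exists 0; rewrite subrr mul0mx.
- move=> y; have /asboolP/ext_class_total[d yd] := valP y.
  have [|x /asboolP x0 xc] := @ext_class_onto F n k n_gt1 I J cardI cardJ P (d *m g).
    by rewrite scalemxAl; apply/gP/(ext_class_torsion yd).
  by exists (Sub x x0), (d *m g), d; split=> //; rewrite -opprB; apply/in_imN/gfK.
- move=> x y [c [d [xc yd cd]]].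
  have xE : x \in coboundary (P := P) (N := LJ) <-> in_im (hom_mx F I J) c.
    by rewrite -(ext_class_coboundary xc); split=> /asboolP.
  have yE : y \in coboundary (P := Q) (N := LI) <-> in_im (hom_mx F J I) d.
    by rewrite -(ext_class_coboundary yd); split=> /asboolP.
  rewrite xE yE; split=> [/fP cf|d_im]; first by rewrite -[d](subrK (c *m f)); apply: in_imD.
  have /gP cfg : in_im (hom_mx F J I) (c *m f).
    by rewrite -[c *m f](subKr d); apply: in_imB.
  by rewrite -[c](subKr (c *m f *m g)); apply: in_imB.
Qed.
End Symmetry.

Theorem theorem3p6 (F : closedFieldType) (n k : nat)
    (n_ge2 : (2 <= n)%N) (k_bounds : (1 <= k <= n - 1)%N)
    (I J : {set 'Z_n}) (cardI : #|I| = k) (cardJ : #|J| = k)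
    (P : proj_resolution (rank1 F n_ge2 cardI))
    (Q : proj_resolution (rank1 F n_ge2 cardJ)) :
  exists phi : {linear Ext1 P (rank1 F n_ge2 cardJ) -> Ext1 Q (rank1 F n_ge2 cardI)},
    bijective phi.
Proof. exact: Ext1_rank1_symmetric. Qed.
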